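(* Let $m,n\ge 1$. (A) Let $\mu$ be a Borel measure on $F^{m\times n}$ which is contracting almost everywhere. Then $\mu$ is extremal if and only if $\mu$ is inhomogeneously extremal. (B) Let $\mu$ be a Borel measure on $F^{m\times n}$ which is strongly contracting almost everywhere. Then $\mu$ is strongly extremal if and only if $\mu$ is inhomogeneously strongly extremal.
   Context: Let $q=p^d$ with $p$ prime, $\Lambda=\mathbb{F}_q[X]$ and $F=\mathbb{F}_q((X^{-1}))$, with absolute value $|0|=0$ and $|\sum_{\ell\le \ell_0}a_\ell X^\ell|=e^{\ell_0}$ when $a_{\ell_0}\neq0$. Vectors in $F^k$ carry the sup norm $\|\mathbf y\|=\max_i|y_i|$; $F^{m\times n}$ (the $m\times n$ matrices over $F$) is identified with $F^{mn}$ with the sup norm. For $\mathbf y\in F^m$ put $\prod(\mathbf y)=\prod_{j=1}^m|y_j|$, and for $\mathbf q\in\Lambda^n$ put $\prod_+(\mathbf q)=\prod_{i=1}^n\max\{1,|q_i|\}$. For $Y\in F^{m\times n}$, $\boldsymbol\theta\in F^m$: $\omega(Y,\boldsymbol\theta)$ is the supremum of reals $\omega\ge0$ such that for arbitrarily large $T\ge1$ there is $(\mathbf p,\mathbf q)\in\Lambda^m\times(\Lambda^n\setminus\{0\})$ with $\|Y\mathbf q+\mathbf p+\boldsymbol\theta\|^m<e^{-\omega T}$ and $\|\mathbf q\|^n<e^T$; $\omega^\times(Y,\boldsymbol\theta)$ is defined the same way with the conditions $\prod(Y\mathbf q+\mathbf p+\boldsymbol\theta)<e^{-\omega T}$ and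 $\prod_+(\mathbf q)<e^T$. Put $\omega(Y)=\omega(Y,\mathbf 0)$, $\omega^\times(Y)=\omega^\times(Y,\mathbf 0)$. A measure $\mu$ on $F^{m\times n}$ is extremal (resp. strongly extremal) if $\omega(Y)=1$ (resp. $\omega^\times(Y)=1$) for $\mu$-a.e. $Y$; it is inhomogeneously extremal (resp. inhomogeneously strongly extremal) if for every $\boldsymbol\theta\in F^m$, $\omega(Y,\boldsymbol\theta)=1$ (resp. $\omega^\times(Y,\boldsymbol\theta)=1$) for $\mu$-a.e. $Y$. For a ball $B$ and $a>0$, $aB$ is the ball with the same centre and $a$ times the radius. The support $S$ of $\mu$ is the smallest closed set of full measure. $\mu$ is non-atomic if points have measure $0$, and doubling if there is $c>0$ with $\mu(2B)\le c\mu(B)$ for every ball $B$ centred in $S$. For $\mathbf b\in F^n$ with $\|\mathbf b\|=1$, $\mathbf c=(c_1,\dots,c_m)\in F^m$ and $\boldsymbol\varepsilon=(\varepsilon_1,\dots,\varepsilon_m)\in(0,\infty)^m$, set $\mathcal L_{\mathbf b,\mathbf c}^{(\boldsymbol\varepsilon)}=\{Y\in F^{m\times n}:|Y_i\mathbf b+c_i|<\varepsilon_i\ \forall i\}$, where $Y_i$ is the $i$-th row of $Y$. A finite, non-atomic, doubling Borel measure $\mu$ on $F^{m\times n}$ with support $S$ is strongly contracting if there are $C,\alpha,r_0>0$ such that for all such $\mathbf b,\mathbf c$, every $\boldsymbol\varepsilon$ with $\min_j\varepsilon_j<r_0$ and every $0<\delta<1$: for every $Y\in\mathcal L_{\mathbf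 b,\mathbf c}^{(\delta\boldsymbol\varepsilon)}\cap S$ there is an open ball $B$ centred at $Y$ with $B\cap S\subset\mathcal L_{\mathbf b,\mathbf c}^{(\boldsymbol\varepsilon)}$ and $\mu(5B\cap\mathcal L_{\mathbf b,\mathbf c}^{(\delta\boldsymbol\varepsilon)})\le C\delta^\alpha\mu(5B)$. It is contracting if this holds for all $\boldsymbol\varepsilon$ with $\varepsilon_1=\dots=\varepsilon_m$. $\mu$ is (strongly) contracting almost everywhere if for $\mu$-a.e. $Y_0$ there is a neighbourhood $V$ of $Y_0$ such that the restriction $\mu|_V$ is (strongly) contracting. *)

(* Defs.v *)
From HB Require Import structures.
From mathcomp Require Import all_boot all_order all_algebra.
From mathcomp Require Import all_classical all_reals all_analysis.
From mathcomp Require Import zify ring.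

Set Implicit Arguments.
Unset Strict Implicit.
Unset Printing Implicit Defensive.

Import Order.TTheory GRing.Theory Num.Theory.

Local Open Scope classical_set_scope.
Local Open Scope ring_scope.

(* Elements of K((X^-1)): [x l] is the coefficient of X^l; only finitely many
   positive powers of X occur. *)
Record laurent (K : fieldType) := Laurent {
  lcoef :> int -> K ;
  lcoefP : exists N : int, forall l, N < l -> lcoef l = 0 }.

HB.instance Definition _ (K : fieldType) := gen_eqMixin (laurent K).
HB.instance Definition _ (K : fieldType) := gen_choiceMixin (laurent K).

Section LaurentRing.
Variable K : fieldType.
Implicit Types (x y z : laurent K) (l N M : int).

Lemma laurentP x y : x =1 y -> x = y.
Proof.
case: x y => [f fP] [g gP] /= /funext fg.
by case: _ / fg gP => gP; congr Laurent; exact: Prop_irrelevance.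
Qed.

Definition deg_le x N := forall l, N < l -> x l = 0.

Lemma lzero_subproof : exists N : int, forall l, N < l -> (fun=> 0 : K) l = 0.
Proof. by exists 0. Qed.
Definition lzero := Laurent lzero_subproof.

Lemma lone_subproof :
  exists N : int, forall l, N < l -> (fun l => (l == 0)%:R : K) l = 0.
Proof. by exists 0 => l l0; rewrite gt_eqF. Qed.
Definition lone := Laurent lone_subproof.

Lemma lopp_subproof x :
  exists N : int, forall l, N < l -> (fun l => - x l) l = 0.
Proof. by have [N xN] := lcoefP x; exists N => l /xN ->; rewrite oppr0. Qed.
Definition lopp x := Laurent (lopp_subproof x).

Lemma ladd_subproof x y :
  exists N : int, forall l, N < l -> (fun l => x l + y l) l = 0.
Proof.
have [N xN] := lcoefP x; have [M yM] := lcoefP y.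
exists (Num.max N M) => l; rewrite gt_max => /andP[/xN -> /yM ->].
by rewrite addr0.
Qed.
Definition ladd x y := Laurent (ladd_subproof x y).

(* Cauchy product; by [lmulE] the sum has finite support. *)
Definition lmul_fun x y l : K := \sum_(i \in [set: int]) (x i * y (l - i)).

Lemma lmulE x y l (r : seq int) : uniq r ->
  (forall i, i \notin r -> x i * y (l - i) = 0) ->
  lmul_fun x y l = \sum_(i <- r) x i * y (l - i).
Proof.
move=> ur r0; rewrite /lmul_fun (fsbigE r)//; last by move=> i _; exact: r0.
by apply: eq_bigl => i; rewrite in_setT.
Qed.

Lemma lmul_window x y N M (k : nat) : deg_le x N -> deg_le y M ->
  lmul_fun x y (N + M - k%:Z)
  = \sum_(i < k.+1) x (N - i%:Z) * y (M - (k - i)%:Z).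
Proof.
move=> xN yM.
rewrite (@lmulE _ _ _ [seq N - i%:Z | i <- iota 0 k.+1]).
- rewrite big_map -[iota 0 _]/(index_iota 0 k.+1) big_mkord.
  apply: eq_bigr => i _; congr (_ * y _).
  by rewrite -subzn; [ring | rewrite -ltnS].
- by rewrite map_inj_uniq ?iota_uniq// => i j /addrI/oppr_inj[].
- move=> i ir; have [/xN->|iN] := ltP N i; first by rewrite mul0r.
  rewrite yM ?mulr0//; rewrite ltNge; apply: contra ir => ik.
  apply/mapP; exists `|N - i|%N; last by lia.
  by rewrite mem_iota; lia.
Qed.

Lemma lmul_deg x y N M : deg_le x N -> deg_le y M ->
  forall l, N + M < l -> lmul_fun x y l = 0.
Proof.
move=> xN yM l lNM; rewrite /lmul_fun fsbig1// => i _.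
have [/xN->|iN] := ltP N i; first by rewrite mul0r.
by rewrite yM ?mulr0//; lia.
Qed.

Lemma lmul_subproof x y :
  exists N : int, forall l, N < l -> lmul_fun x y l = 0.
Proof.
have [N xN] := lcoefP x; have [M yM] := lcoefP y.
by exists (N + M); exact: lmul_deg.
Qed.
Definition lmul x y := Laurent (lmul_subproof x y).

Let laddA : associative ladd.
Proof. by move=> x y z; apply: laurentP => l /=; rewrite addrA. Qed.
Let laddC : commutative ladd.
Proof. by move=> x y; apply: laurentP => l /=; rewrite addrC. Qed.
Let ladd0 : left_id lzero ladd.
Proof. by move=> x; apply: laurentP => l /=; rewrite add0r. Qed.
Let laddN : left_inverse lzero lopp ladd.
Proof. by move=> x; apply: laurentP => l /=; rewrite addNr. Qed.

HB.instance Definition _ :=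
  GRing.isZmodule.Build (laurent K) laddA laddC ladd0 laddN.

(* The first [k] coefficients from X^N down, as a polynomial in X^-1. *)
Let win N (k : nat) x : {poly K} := \poly_(i < k) x (N - i%:Z).

Let lmul_win x y N M (k j : nat) : deg_le x N -> deg_le y M -> (j < k)%N ->
  lmul x y (N + M - j%:Z) = (win N k x * win M k y)`_j.
Proof.
move=> xN yM jk; rewrite /= lmul_window// coefM; apply: eq_bigr => i _.
by have ij := ltn_ord i; rewrite !coef_poly !ifT//; lia.
Qed.

Let deg_le_window x y N : deg_le x N -> deg_le y N ->
  (forall k : nat, x (N - k%:Z) = y (N - k%:Z)) -> x = y.
Proof.
move=> xN yN xy; apply: laurentP => l; have [lN|lN] := ltP N l.
  by rewrite xN// yN.
by have := xy `|N - l|%N; rewrite (_ : _ - _ = l)//; lia.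
Qed.

Let lmulC : commutative lmul.
Proof.
move=> x y; have [N xN] := lcoefP x; have [M yM] := lcoefP y.
apply: (@deg_le_window _ _ (N + M)) => [||k].
- exact: lmul_deg.
- by rewrite /deg_le addrC; exact: lmul_deg.
rewrite (@lmul_win _ _ _ _ k.+1)// mulrC.
by rewrite [N + M]addrC (@lmul_win _ _ _ _ k.+1).
Qed.

Let lmulA : associative lmul.
Proof.
move=> x y z; have [N xN] := lcoefP x; have [M yM] := lcoefP y.
have [P zP] := lcoefP z.
have xyNM : deg_le (lmul x y) (N + M) by exact: lmul_deg.
have yzMP : deg_le (lmul y z) (M + P) by exact: lmul_deg.
apply: (@deg_le_window _ _ (N + M + P)) => [||k].
- by rewrite -addrA; exact: lmul_deg.
- exact: lmul_deg.
rewrite (@lmul_win _ z _ _ k.+1)// -(addrA N) (@lmul_win _ _ _ _ k.+1)//.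
transitivity (win N k.+1 x * (win M k.+1 y * win P k.+1 z))`_k.
  rewrite !coefM; apply: eq_bigr => i _; congr (_ * _).
  by have ij := ltn_ord i; rewrite coef_poly ifT ?(@lmul_win _ _ _ _ k.+1)//; lia.
rewrite mulrA !coefM; apply: eq_bigr => i _; congr (_ * _).
by have ij := ltn_ord i; rewrite coef_poly ifT ?(@lmul_win _ _ _ _ k.+1)//; lia.
Qed.

Let lmul1 : left_id lone lmul.
Proof.
move=> x; apply: laurentP => l /=.
rewrite (@lmulE _ _ _ [:: 0])// ?big_seq1 /= ?eqxx ?mul1r ?subr0//.
by move=> i; rewrite inE => /negPf i0 /=; rewrite i0 mul0r.
Qed.

Let lmulD : left_distributive lmul +%R.
Proof.
move=> x y z; have [N1 xN] := lcoefP x; have [N2 yN] := lcoefP y.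
have [P zP] := lcoefP z; set N := Num.max N1 N2.
have {}xN : deg_le x N by move=> l; rewrite gt_max => /andP[/xN].
have {}yN : deg_le y N by move=> l; rewrite gt_max => /andP[_ /yN].
have xyN : deg_le (x + y) N by move=> l lN /=; rewrite xN// yN// addr0.
apply: (@deg_le_window _ _ (N + P)) => [||k].
- exact: lmul_deg.
- by move=> l lN /=; rewrite !(lmul_deg _ _ lN)// addr0.
rewrite /= !lmul_window// -big_split; apply: eq_bigr => i _.
by rewrite mulrDl.
Qed.

Let lone_neq0 : lone != 0 :> laurent K.
Proof.
by apply/eqP => /(congr1 (fun x : laurent K => x 0))/eqP; rewrite /= oner_eq0.
Qed.

HB.instance Definition _ := GRing.Zmodule_isComNzRing.Build (laurent K)
  lmulA lmulC lmul1 lmulD lone_neq0.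

Lemma lcoef0 l : (0 : laurent K) l = 0. Proof. by []. Qed.
Lemma lcoef1 l : (1 : laurent K) l = (l == 0)%:R. Proof. by []. Qed.
Lemma lcoefD x y l : (x + y) l = x l + y l. Proof. by []. Qed.
Lemma lcoefN x l : (- x) l = - x l. Proof. by []. Qed.
Lemma lcoefB x y l : (x - y) l = x l - y l. Proof. by []. Qed.
Lemma lcoefM x y l : (x * y) l = \sum_(i \in [set: int]) (x i * y (l - i)).
Proof. by []. Qed.

Definition is_deg x l := x l != 0 /\ deg_le x l.

Lemma is_deg_ex x : x != 0 -> exists l, is_deg x l.
Proof.
move=> x0; have [N xN] := lcoefP x.
have ex : exists k : nat, x (N - k%:Z) != 0.
  apply: contrapT => /forallNP x0'; move/eqP: x0; apply.
  apply: (@deg_le_window _ _ N) => // k.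
  by have /negP := x0' k; rewrite negbK => /eqP.
case: (ex_minnP ex) => k xk kmin; exists (N - k%:Z); split=> // l lk.
have [/xN//|lN] := ltP N l; apply/eqP; apply: contraLR lk => xl.
have := kmin `|N - l|%N; rewrite (_ : _ - _ = l); last by lia.
by move/(_ xl); lia.
Qed.

Lemma is_deg_uniq x l l' : is_deg x l -> is_deg x l' -> l = l'.
Proof.
move=> [xl xle] [xl' xle']; apply: le_anti; rewrite !leNgt; apply/andP; split.
  by apply: contra xl => /xle' ->.
by apply: contra xl' => /xle ->.
Qed.

Fixpoint linv_seq (a : nat -> K) (k : nat) : seq K :=
  if k is k'.+1 then
    let s := linv_seq a k' in
    rcons s ((a 0)^-1 *
      ((k' == 0)%:R - \sum_(i < k') a (k' - i)%N * nth 0 s i))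
  else [::].

Let size_linv_seq a k : size (linv_seq a k) = k.
Proof. by elim: k => //= k IH; rewrite size_rcons IH. Qed.

Let nth_linv_seq a k j : (j < k)%N ->
  nth 0 (linv_seq a k) j = nth 0 (linv_seq a j.+1) j.
Proof.
elim: k => // k IH; rewrite ltnS leq_eqVlt => /predU1P[->//|jk].
by rewrite [in LHS]/= nth_rcons size_linv_seq jk IH.
Qed.

Lemma laurent_inv_ex x : x != 0 -> exists y, y * x = 1.
Proof.
move=> /is_deg_ex[d [xd0 xd]]; pose a (k : nat) := x (d - k%:Z).
pose b (k : nat) := nth 0 (linv_seq a k.+1) k.
have ab k : \sum_(i < k.+1) b i * a (k - i)%N = (k == 0)%:R.
  rewrite big_ord_recr /= subnn {2}/b [linv_seq _ _]/= nth_rcons size_linv_seq.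
  rewrite ltnn eqxx mulrAC mulVf ?mul1r; last by rewrite /a subr0.
  rewrite addrC [X in _ - X](_ : _ = \sum_(i < k) b i * a (k - i)%N).
    by rewrite subrK.
  by apply: eq_bigr => i _; rewrite mulrC nth_linv_seq.
pose f (l : int) := if l <= - d then b `|- d - l|%N else 0.
have fP : exists N : int, forall l, N < l -> f l = 0.
  by exists (- d) => l dl; rewrite /f leNgt dl.
have fd : deg_le (Laurent fP) (- d) by move=> l dl; rewrite /= /f leNgt dl.
exists (Laurent fP); apply: (@deg_le_window _ _ (- d + d)).
- exact: lmul_deg.
- by move=> l; rewrite addNr => l0; rewrite lcoef1 gt_eqF.
move=> k; rewrite [LHS]/= lmul_window// lcoef1 addNr sub0r oppr_eq0.
rewrite -[_ == 0 :> int]/(k == 0%N) -ab; apply: eq_bigr => i _.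
by have ij := ltn_ord i; rewrite /= /f ifT; [congr (b _ * _) |]; lia.
Qed.

Definition linv x : laurent K := xget 0 [set y | y * x = 1].

Let linvP x : x != 0 -> linv x * x = 1.
Proof.
move=> /laurent_inv_ex[y yx].
by apply: (@xgetPex _ 0 [set y | y * x = 1]); exists y.
Qed.

Let linv0 : linv 0 = 0.
Proof.
by rewrite /linv xgetPN// => y /= /eqP; rewrite mulr0 eq_sym oner_eq0.
Qed.

HB.instance Definition _ := GRing.ComNzRing_isField.Build (laurent K) linvP linv0.

Lemma lpoly_subproof (p : {poly K}) : exists N : int, forall l, N < l ->
  (fun l : int => if l is Posz i then p`_i else 0) l = 0.
Proof.
exists (size p)%:Z => -[i|//] pi; rewrite nth_default//; exact: ltnW.
Qed.
Definition lpoly (p : {poly K}) : laurent K := Laurent (lpoly_subproof p).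

Let lpoly_is_zmod_morphism : zmod_morphism lpoly.
Proof.
by move=> p q; apply: laurentP => -[i|i]; rewrite lcoefB /= ?coefB ?subr0.
Qed.

HB.instance Definition _ :=
  GRing.isZmodMorphism.Build {poly K} (laurent K) lpoly lpoly_is_zmod_morphism.

Let lpoly_is_monoid_morphism : monoid_morphism lpoly.
Proof.
split; first by apply: laurentP => -[i|i]; rewrite lcoef1 /= ?coef1.
move=> p q; apply: laurentP => -[l|l]; last first.
  rewrite lcoefM fsbig1// => -[i|i] _ /=; rewrite ?mul0r//.
  by case E : (_ - _) => [j|j]; rewrite ?mulr0//; lia.
rewrite [RHS](@lmulE _ _ _ [seq i%:Z | i <- iota 0 l.+1]).
- rewrite big_map -[iota 0 _]/(index_iota 0 l.+1) big_mkord /= coefM.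
  apply: eq_bigr => i _; congr (_ * _).
  by rewrite subzn// -ltnS.
- by rewrite map_inj_uniq ?iota_uniq// => i j [].
- move=> [i|i] il; last by rewrite /= mul0r.
  case E : (_ - _) => [j|j]; last by rewrite /= mulr0.
  case/negP: il; apply/mapP; exists i => //; rewrite mem_iota; lia.
Qed.

HB.instance Definition _ := GRing.isMonoidMorphism.Build
  {poly K} (laurent K) lpoly lpoly_is_monoid_morphism.

End LaurentRing.

Section AbsoluteValue.
Variables (R : realType) (K : fieldType).
Implicit Types (x y z : laurent K) (l N : int).

Definition ldeg x : int := xget 0 [set l | is_deg x l].

Definition labs x : R := if x == 0 then 0 else expR (ldeg x)%:~R.

Lemma labs0 : labs 0 = 0. Proof. by rewrite /labs eqxx. Qed.

Lemma labsE x l : is_deg x l -> labs x = expR l%:~R.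
Proof.
move=> xl; rewrite /labs ifF.
  congr (expR _%:~R); apply: (is_deg_uniq _ xl).
  by apply: (@xgetPex _ 0 [set l | is_deg x l]); exists l.
by apply/negP => /eqP x0; case: xl; rewrite x0 eqxx.
Qed.

Lemma labs_ge0 x : 0 <= labs x.
Proof. by rewrite /labs; case: ifP => // _; exact: expR_ge0. Qed.

Lemma labs_eq0 x : (labs x == 0) = (x == 0).
Proof. by rewrite /labs; case: ifP => _; rewrite ?eqxx// gt_eqF// expR_gt0. Qed.

Lemma labs_ltP x N :
  labs x < expR N%:~R <-> (forall l, N <= l -> x l = 0).
Proof.
have [->|/is_deg_ex[d xd]] := eqVneq x 0; first by rewrite labs0 expR_gt0.
rewrite (labsE xd) ltr_expR ltr_int; case: xd => xd xdle.
split=> [dN l Nl|x0]; first by apply: xdle; exact: lt_le_trans Nl.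
by rewrite ltNge; apply: contra xd => /x0 ->.
Qed.

Lemma labsN x : labs (- x) = labs x.
Proof.
have [->|/is_deg_ex[d xd]] := eqVneq x 0; first by rewrite oppr0.
rewrite (labsE xd); apply: labsE; split; first by rewrite lcoefN oppr_eq0 xd.1.
by move=> l /xd.2 xl; rewrite lcoefN xl oppr0.
Qed.

Lemma labsD x y : labs (x + y) <= Num.max (labs x) (labs y).
Proof.
have [->|/is_deg_ex[d xyd]] := eqVneq (x + y) 0.
  by rewrite labs0 le_max labs_ge0.
rewrite (labsE xyd) leNgt gt_max; apply/negP => /andP[/labs_ltP xd /labs_ltP yd].
by case: xyd; rewrite lcoefD xd// yd// addr0 eqxx.
Qed.

Lemma labsM x y : labs (x * y) = labs x * labs y.
Proof.
have [->|/is_deg_ex[d xd]] := eqVneq x 0; first by rewrite mul0r labs0 mul0r.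
have [->|/is_deg_ex[e ye]] := eqVneq y 0; first by rewrite mulr0 labs0 mulr0.
rewrite (labsE xd) (labsE ye) -expRD -intrD; apply: labsE.
case: xd ye => xd xdle [ye yele]; split; last exact: lmul_deg.
have := lmul_window 0 xdle yele; rewrite !subr0 => xyE.
rewrite [X in X != 0]xyE big_ord_recl big_ord0 addr0 /= !subr0.
by rewrite mulf_neq0.
Qed.

End AbsoluteValue.

Section LaurentTopology.
Variable K : fieldType.
Local Open Scope relation_scope.
Implicit Types (x y z : laurent K) (l N : int).

HB.instance Definition _ := isPointed.Build (laurent K) 0.

(* The uniformity of the absolute value, expressed on coefficients so that it
   does not depend on a type of real numbers; the metric is given below. *)
Definition lent : set_system (laurent K * laurent K) :=
  filter_from [set: int]
    (fun N => [set xy : laurent K * laurent K |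
      forall l, N <= l -> xy.1 l = xy.2 l]).

Let lent_filter : Filter lent.
Proof.
apply: filter_from_filter; first by exists 0.
move=> M N _ _; exists (Num.min M N) => // -[x y] xy.
by split=> l Nl; apply: xy; rewrite ge_min Nl ?orbT.
Qed.

Let lent_diag A : lent A -> diagonal `<=` A.
Proof. by move=> [N _ NA] [x y] xy; apply: NA => l _; rewrite [x]xy. Qed.

Let lent_inv A : lent A -> lent A^-1.
Proof. by move=> [N _ NA]; exists N => // -[x y] xy; apply: NA => l /xy. Qed.

Let lent_split A : lent A -> exists2 B, lent B & B \; B `<=` A.
Proof.
move=> [N _ NA]; exists [set xy : laurent K * laurent K |
  forall l, N <= l -> xy.1 l = xy.2 l]; first by exists N.
by move=> [x z] [y xy yz]; apply: NA => l Nl; exact: etrans (xy l Nl) (yz l Nl).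
Qed.

HB.instance Definition _ :=
  isUniform.Build (laurent K) lent_filter lent_diag lent_inv lent_split.

End LaurentTopology.

Section LaurentMetric.
Variables (R : realType) (K : fieldType).
Implicit Types (x y z : laurent K).

Definition lball x (e : R) y := labs R (x - y) < e.

Let lball_center x (e : R) : 0 < e -> lball x e x.
Proof. by rewrite /lball subrr labs0. Qed.

Let lball_sym x y (e : R) : lball x e y -> lball y e x.
Proof. by rewrite /lball -labsN opprB. Qed.

Let lball_triangle x y z (e1 e2 : R) :
  lball x e1 y -> lball y e2 z -> lball x (e1 + e2) z.
Proof.
rewrite /lball => xy yz; rewrite -(subrKA y); apply: le_lt_trans (labsD _ _ _) _.
rewrite gt_max (lt_le_trans xy) ?(lt_le_trans yz)//.
- by rewrite lerDr; exact: le_trans (labs_ge0 _ _) (ltW xy).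
- by rewrite lerDl; exact: le_trans (labs_ge0 _ _) (ltW yz).
Qed.

Let lball_entourage : entourage = entourage_ lball.
Proof.
apply/seteqP; split=> A.
  move=> [N _ NA]; exists (expR N%:~R) => /=; first exact: expR_gt0.
  move=> [x y] /labs_ltP xy; apply: NA => l /xy/eqP.
  by rewrite lcoefB subr_eq0 => /eqP.
move=> [e /= e0 eA]; exists (Num.floor (ln e)) => // -[x y] /= xy.
apply: eA; rewrite /= /lball; apply: (@lt_le_trans _ _ (expR (Num.floor (ln e))%:~R)).
  by apply/labs_ltP => l /xy; rewrite lcoefB => ->; rewrite subrr.
by rewrite -[leRHS]lnK// ler_expR floor_le.
Qed.

(* On matrices, the library's [ball Y r] is then the open ball of centre [Y]
   and radius [r] for the sup norm. *)
HB.instance Definition _ := Uniform_isPseudoMetric.Build R (laurent K)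
  lball_center lball_sym lball_triangle lball_entourage.

End LaurentMetric.

Section Exponents.
Variables (R : realType) (K : fieldType).
Local Notation F := (laurent K).
Local Notation Lambda := {poly K}.

Definition supnorm k (y : 'cV[F]_k) : R := \big[Num.max/0]_(i < k) labs R (y i 0).

Definition prodabs k (y : 'cV[F]_k) : R := \prod_(i < k) labs R (y i 0).

Definition prodabs_plus k (y : 'cV[F]_k) : R :=
  \prod_(i < k) Num.max 1 (labs R (y i 0)).

Definition lpolyv k (p : 'cV[Lambda]_k) : 'cV[F]_k := map_mx (@lpoly K) p.

Variables m n : nat.
Implicit Types (Y : 'M[F]_(m, n)) (theta : 'cV[F]_m).

Definition omega Y theta : \bar R :=
  ereal_sup [set w%:E | w in [set w : R | 0 <= w /\
    forall T0 : R, exists T : R, [/\ T0 <= T, 1 <= T &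
      exists (p : 'cV[Lambda]_m) (q : 'cV[Lambda]_n), [/\ q != 0,
        supnorm (Y *m lpolyv q + lpolyv p + theta) ^+ m < expR (- w * T) &
        supnorm (lpolyv q) ^+ n < expR T]]]].

Definition omega_times Y theta : \bar R :=
  ereal_sup [set w%:E | w in [set w : R | 0 <= w /\
    forall T0 : R, exists T : R, [/\ T0 <= T, 1 <= T &
      exists (p : 'cV[Lambda]_m) (q : 'cV[Lambda]_n), [/\ q != 0,
        prodabs (Y *m lpolyv q + lpolyv p + theta) < expR (- w * T) &
        prodabs_plus (lpolyv q) < expR T]]]].

End Exponents.

Notation borel T := (g_sigma_algebraType (@open T)).

Section Measures.
Variables (R : realType) (K : finFieldType) (m n : nat).
Local Notation F := (laurent K).
Local Notation Mat := 'M[F]_(m, n).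
Implicit Types mu : {measure set (borel Mat) -> \bar R}.

Definition extremal mu := {ae mu, forall Y : Mat, omega R Y 0 = 1%:E}.

Definition strongly_extremal mu :=
  {ae mu, forall Y : Mat, omega_times R Y 0 = 1%:E}.

Definition inhom_extremal mu :=
  forall theta : 'cV[F]_m, {ae mu, forall Y : Mat, omega R Y theta = 1%:E}.

Definition inhom_strongly_extremal mu :=
  forall theta : 'cV[F]_m, {ae mu, forall Y : Mat, omega_times R Y theta = 1%:E}.

Definition msupport mu : set Mat :=
  \bigcap_(C in [set C : set Mat | closed C /\ mu (~` C) = 0%E]) C.

Definition nonatomic mu := forall Y : Mat, mu [set Y] = 0%E.

Definition doubling mu := exists2 c : R, 0 < c &
  forall (Y : Mat) (r : R), msupport mu Y -> 0 < r ->
    (mu (ball Y (2 * r)) <= c%:E * mu (ball Y r))%E.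

Definition affine_nbhd (b : 'cV[F]_n) (c : 'cV[F]_m) (eps : 'I_m -> R) :
    set Mat :=
  [set Y | forall i, labs R ((Y *m b) i 0 + c i 0) < eps i].

(* [E] restricts the vectors [eps]: all of them for strong contraction, the
   constant ones for contraction. [exists j, eps j < r0] is [min_j eps_j < r0].
   The dilates 2B and 5B of an open ball B are taken with respect to the centre
   and radius chosen to present B, which B as a set does not determine. *)
Definition contracting_for (E : set ('I_m -> R)) mu :=
  [/\ (mu setT < +oo)%E, nonatomic mu, doubling mu &
    exists C alpha r0 : R, [/\ 0 < C, 0 < alpha, 0 < r0 &
      forall (b : 'cV[F]_n) (c : 'cV[F]_m) (eps : 'I_m -> R) (delta : R),
        supnorm R b = 1 -> E eps -> (forall j, 0 < eps j) ->
        (exists j, eps j < r0) -> 0 < delta < 1 ->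
        let L := affine_nbhd b c eps in
        let Ldelta := affine_nbhd b c (fun j => delta * eps j) in
        forall Y : Mat, (Ldelta `&` msupport mu) Y ->
          exists2 r : R, 0 < r &
            ball Y r `&` msupport mu `<=` L /\
            (mu (ball Y (5 * r) `&` Ldelta)
               <= (C * delta `^ alpha)%:E * mu (ball Y (5 * r)))%E]].

Definition strongly_contracting mu := contracting_for setT mu.

Definition contracting mu :=
  contracting_for [set eps | forall i j, eps i = eps j] mu.

Definition almost_everywhere_locally
    (P : {measure set (borel Mat) -> \bar R} -> Prop) mu :=
  {ae mu, forall Y0 : Mat, exists (V : set (borel Mat)) (mV : measurable V),
    nbhs Y0 (V : set Mat) /\ P (mrestr mu mV)}.

Definition contracting_ae := almost_everywhere_locally contracting.

Definition strongly_contracting_ae :=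
  almost_everywhere_locally strongly_contracting.

End Measures.

(* Main.v *)
Require Import Defs.
From mathcomp Require Import all_boot all_order all_algebra.
From mathcomp Require Import all_classical all_reals all_analysis.
From mathcomp Require Import zify ring lra.

(* Fix theta and a box shape tau at time T. If Y satisfies the inhomogeneous inequalities
   for two pairs (p, q), then, the absolute value being ultrametric, it satisfies the
   homogeneous inequalities of the same shape for their difference. As mu is extremal, for
   almost every Y this is impossible for large T, so that the solution (p, q) is unique.
   Around such a point the contraction property, applied to the neighbourhood of the affine
   subspace of (p, q), gives a ball in which the solution set at scale delta has proportion
   O(delta^alpha). Balls being nested or disjoint, these estimates add up to a bound
   O(delta^alpha) for the whole solution set, and with delta = e^-ct the Borel-Cantelli
   lemma yields omega(Y, theta) <= 1 almost everywhere.

   Conversely omega(Y) <= 1 implies omega(Y, theta) >= 1 for every theta: if Yq + p has no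
   small value for |q| < e^b, counting shows that the vectors of F^m approximable by some
   Yq + p form a subspace of small codimension, and each dilation of the box by X strictly
   decreases this codimension until it vanishes. *)

Set Implicit Arguments.
Unset Strict Implicit.
Unset Printing Implicit Defensive.

Import Order.TTheory GRing.Theory Num.Theory.
Import numFieldNormedType.Exports.

Local Open Scope classical_set_scope.
Local Open Scope ring_scope.

(** * The absolute value *)

Section AbsoluteValueTheory.
Variables (R : realType) (K : fieldType).
Implicit Types (x y : laurent K) (e : R).

Lemma labsD_lt x y e : labs R x < e -> labs R y < e -> labs R (x + y) < e.
Proof. by move=> xe ye; rewrite (le_lt_trans (labsD _ _ _))// gt_max xe. Qed.

Lemma labsB_lt x y e : labs R x < e -> labs R y < e -> labs R (x - y) < e.
Proof. by move=> xe ye; apply: labsD_lt; rewrite ?labsN. Qed.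

Lemma labs_sum_lt (I : Type) (r : seq I) (P : pred I) (f : I -> laurent K) e :
  0 < e -> (forall i, P i -> labs R (f i) < e) ->
  labs R (\sum_(i <- r | P i) f i) < e.
Proof.
move=> e0 fe; elim/big_ind : _ => //; first by rewrite labs0.
by move=> x y; exact: labsD_lt.
Qed.

(** Absolute values are 0 or [expR] of an integer, so a radius can be rounded up to such a value. *)
Lemma labs_lt_expR_ceil x e : 0 < e ->
  (labs R x < e) = (labs R x < expR (Num.ceil (ln e))%:~R).
Proof.
move=> e0; have [->|/is_deg_ex[d xd]] := eqVneq x 0.
  by rewrite labs0 e0 expR_gt0.
rewrite (labsE R xd) -{1}[e]lnK// !ltr_expR.
by rewrite ltr_int ceil_gt_int.
Qed.

Lemma labs_lpoly (p : {poly K}) : p != 0 ->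
  labs R (lpoly p) = expR ((size p).-1)%:R.
Proof.
move=> p0; rewrite pmulrn; apply: labsE; split.
  by rewrite /= -lead_coefE lead_coef_eq0.
move=> [l|l]// pl /=; rewrite nth_default//.
by move: pl; rewrite ltz_nat; case: (size p).
Qed.

Lemma labs_lpoly_lt (p : {poly K}) (k : nat) :
  (labs R (lpoly p) < expR k%:R) = (size p <= k)%N.
Proof.
have [->|p0] := eqVneq p 0.
  by rewrite rmorph0 labs0 expR_gt0 size_poly0.
rewrite labs_lpoly// ltr_expR ltr_nat.
by move: p0; rewrite -size_poly_gt0; lia.
Qed.

Lemma labs_lpoly_lt1 (p : {poly K}) : labs R (lpoly p) < 1 -> p = 0.
Proof.
by rewrite -expR0 -(mulr0n 1) labs_lpoly_lt leqn0 size_poly_eq0 => /eqP.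
Qed.

Lemma labs_lpoly_ge1 (p : {poly K}) : p != 0 -> 1 <= labs R (lpoly p).
Proof. by apply: contraNle => /labs_lpoly_lt1 ->. Qed.

Lemma labs1 : labs R (1 : laurent K) = 1.
Proof. by rewrite -(rmorph1 (@lpoly K)) labs_lpoly ?oner_eq0// size_poly1 expR0. Qed.

Lemma labsX x k : labs R (x ^+ k) = labs R x ^+ k.
Proof. by elim: k => [|k IH]; rewrite ?expr0 ?labs1// !exprS labsM IH. Qed.

Lemma labsV x : x != 0 -> labs R x^-1 = (labs R x)^-1.
Proof.
move=> x0; apply: (mulfI (_ : labs R x != 0)); first by rewrite labs_eq0.
by rewrite -labsM !mulfV ?labs1// labs_eq0.
Qed.

Definition lX : laurent K := lpoly 'X.

Lemma labs_lX : labs R lX = expR 1.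
Proof. by rewrite labs_lpoly ?polyX_eq0// size_polyX. Qed.

Lemma lX_neq0 : lX != 0.
Proof. by rewrite -(labs_eq0 R) labs_lX gt_eqF// expR_gt0. Qed.

Lemma labs_lXz (k : int) : labs R (lX ^ k) = expR k%:~R.
Proof.
case: k => k; rewrite ?NegzE -?exprnP -?exprnN /=.
  by rewrite labsX labs_lX -expRM_natl mulr1.
rewrite labsV ?expf_neq0 ?lX_neq0// labsX labs_lX -expRM_natl mulr1.
by rewrite mulrNz expRN.
Qed.

(** It only bounds the length of the polynomial [lpart]; by [coef_lpart] the choice is
    immaterial. *)
Definition lbound x : int := xget 0 [set N : int | deg_le x N].

Lemma lboundP x : deg_le x (lbound x).
Proof.
have [N xN] := lcoefP x.
by apply: (@xgetPex _ 0 [set N : int | deg_le x N]); exists N.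
Qed.

(* The polynomial part of [X^-k x]. *)
Definition lpart (k : int) x : {poly K} :=
  \poly_(i < `|lbound x - k|%N.+1) x (k + i%:Z).

Lemma coef_lpart k x (i : nat) : (lpart k x)`_i = x (k + i%:Z).
Proof.
rewrite coef_poly; case: ifP => // /negbT; rewrite -leqNgt => ki.
by rewrite (@lboundP x)//; lia.
Qed.

Lemma labs_sub_lpart x : labs R (x - lpoly (lpart 0 x)) < 1.
Proof.
rewrite -[ltRHS]expR0 -[X in expR X](mulr0z 1); apply/labs_ltP => -[l|l]// _.
by rewrite lcoefB /= coef_lpart add0r subrr.
Qed.

Lemma labs_addpoly_lt1 x : exists p, labs R (x + lpoly p) < 1.
Proof. by exists (- lpart 0 x); rewrite rmorphN labs_sub_lpart. Qed.

End AbsoluteValueTheory.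

(** * Covering by balls *)

Section LaminarFamilies.
Local Open Scope ereal_scope.
Context d (T : measurableType d) (R : realType).
Variables (mu nu : {measure set T -> \bar R}).

(** By induction on the length. A head contained in another member is dropped. Otherwise the members
    contained in the head are dropped; the remaining ones are disjoint from it, and both measures
    are additive. *)
Lemma laminar_bigsetU_le (F : (set T)^nat) (s : seq nat) :
  (forall i, measurable (F i)) ->
  (forall i j, [\/ F i `&` F j = set0, F i `<=` F j | F j `<=` F i]) ->
  (forall i, mu (F i) <= nu (F i)) ->
  mu (\big[setU/set0]_(i <- s) F i) <= nu (\big[setU/set0]_(i <- s) F i).
Proof.
move=> mF lF leF; have [n] := ubnP (size s); elim: n s => // n IH [_|i s /= sn].
  by rewrite big_nil !measure0.
rewrite big_cons; have [/hasP[j js /asboolP ij]|noj] :=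
  boolP (has (fun j => `[< F i `<=` F j >]) s).
  have /setUidr -> : F i `<=` \big[setU/set0]_(j <- s) F j.
    by apply: subset_trans ij _; rewrite -bigcup_seq; exact: bigcup_sup.
  exact: IH.
pose s' := [seq j <- s | ~~ `[< F j `<=` F i >]].
have -> : F i `|` \big[setU/set0]_(j <- s) F j =
          F i `|` \big[setU/set0]_(j <- s') F j.
  rewrite -!bigcup_seq; apply/seteqP; split=> x [?|[j /= js Fjx]]; [by left| |by left|].
    have [/asboolP ji|ji] := boolP `[< F j `<=` F i >]; first by left; exact: ji.
    by right; exists j => //=; rewrite mem_filter ji.
  by right; exists j => //; move: js; rewrite /= mem_filter => /andP[].
have disj : F i `&` \big[setU/set0]_(j <- s') F j = set0.
  rewrite -bigcup_seq setI_bigcupr bigcup0// => j /=.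
  rewrite mem_filter => /andP[/asboolP ji js].
  case: (lF i j) => // ij; exfalso; move/negP: noj; apply.
  by apply/hasP; exists j => //; apply/asboolP.
have mU : measurable (\big[setU/set0]_(j <- s') F j).
  by apply: bigsetU_measurable.
rewrite !measureU//; apply: leeD; [exact: leF|apply: IH].
by apply: (@leq_trans (size s).+1) => //; rewrite ltnS size_filter count_size.
Qed.

(** Continuity from below along an enumeration; [G] is empty at codes of no index in [D], which
    keeps the family laminar. *)
Lemma laminar_bigcup_le (I : countType) (D : set I) (F : I -> set T) :
  (forall i, measurable (F i)) ->
  (forall i j, [\/ F i `&` F j = set0, F i `<=` F j | F j `<=` F i]) ->
  (forall i, D i -> mu (F i) <= nu (F i)) ->
  mu (\bigcup_(i in D) F i) <= nu (\bigcup_(i in D) F i).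
Proof.
move=> mF lF leF.
pose G k := if unpickle k is Some i then (if `[< D i >] then F i else set0) else set0.
have GF : \bigcup_(i in D) F i = \bigcup_k G k.
  apply/seteqP; split=> x.
    by move=> [i Di Fix]; exists (pickle i) => //; rewrite /G pickleK asboolT.
  by move=> [k _]; rewrite /G; case: unpickle => // i; case: asboolP => // Di; exists i.
have mG k : measurable (G k).
  by rewrite /G; case: unpickle => // i; case: asboolP.
have lG i j : [\/ G i `&` G j = set0, G i `<=` G j | G j `<=` G i].
  rewrite /G; case: unpickle => [i'|]; last by apply: Or31; rewrite set0I.
  case: asboolP => [Di|_]; last by apply: Or31; rewrite set0I.
  case: unpickle => [j'|]; last by apply: Or31; rewrite setI0.
  by case: asboolP => // _; apply: Or31; rewrite setI0.
have leG k : mu (G k) <= nu (G k).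
  rewrite /G; case: unpickle => [i|]; last by rewrite !measure0.
  by case: asboolP => Di; [exact: leF|rewrite !measure0].
rewrite GF; pose H n := \big[setU/set0]_(i < n) G i.
have mH n : measurable (H n) by exact: bigsetU_measurable.
have mUG : measurable (\bigcup_k G k) by exact: bigcupT_measurable.
have HG : \bigcup_k G k = \bigcup_n H n.
  apply/seteqP; split=> x.
    move=> [k _ Gkx]; exists k.+1 => //.
    by apply: (@bigsetU_sup _ k k.+1 G).
  by move=> [k _ Hk]; exact: bigsetU_bigcup Hk.
have ndH : nondecreasing_seq H by move=> a b ab; apply/subsetPset; exact: subset_bigsetU.
have := @nondecreasing_cvg_mu _ _ _ mu H mH; rewrite -HG => /(_ mUG ndH) cv.
rewrite -(cvg_lim _ cv)//; apply: lime_le.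
  by apply/cvg_ex; eexists; exact: cv.
apply: nearW => n /=; apply: (@le_trans _ _ (nu (H n))).
  by rewrite /H -(big_mkord xpredT G); exact: laminar_bigsetU_le.
by apply: le_measure; rewrite ?inE// HG; exact: bigcup_sup.
Qed.

End LaminarFamilies.

(** * Balls of the matrix space as a countable laminar family *)

Section Cells.
Variables (K : finFieldType) (m n : nat).
Local Notation F := (laurent K).
Local Notation Mat := 'M[F]_(m, n).
Local Notation index := (int * 'M[{poly K}]_(m, n))%type.
Implicit Types (Y : Mat) (k : int).

(** The values are polynomial matrices over a finite field, hence countably many: this makes the
    balls a countable family, as [laminar_bigcup_le] and [negligible_locally] require. *)
Definition mxpart k Y : 'M[{poly K}]_(m, n) := map_mx (lpart k) Y.

(* The balls of [Mat]; [cell (k, mxpart k Y)] is the one of centre [Y] and radius e^k. *)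
Definition cell (i : index) : set Mat := [set Y | mxpart i.1 Y = i.2].

Lemma lpart_eqP k (x y : F) :
  lpart k x = lpart k y <-> forall l, k <= l -> x l = y l.
Proof.
split=> [xy l kl|xy]; last by apply/polyP => i; rewrite !coef_lpart xy//; lia.
have := congr1 (fun p : {poly K} => p`_`|l - k|%N) xy; rewrite !coef_lpart.
by rewrite (_ : k + _ = l)//; lia.
Qed.

Lemma cellP k Y Z :
  cell (k, mxpart k Y) Z <-> forall i j l, k <= l -> Y i j l = Z i j l.
Proof.
split=> [/= ZY i j l kl|YZ].
  have := congr1 (fun M : 'M[{poly K}]_(m, n) => M i j) ZY; rewrite !mxE.
  by move/lpart_eqP => ->.
by apply/matrixP => i j; rewrite !mxE; apply/lpart_eqP => l /YZ ->.
Qed.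

Lemma ball_cell (R : realType) Y (r : R) : 0 < r ->
  ball Y r = cell (Num.ceil (ln r), mxpart (Num.ceil (ln r)) Y).
Proof.
move=> r0; apply/seteqP; split=> Z.
  move=> [_ YZ]; apply/cellP => i j l kl.
  have : labs R (Y i j - Z i j) < r := YZ i j.
  rewrite labs_lt_expR_ceil// => /labs_ltP/(_ l kl)/eqP.
  by rewrite lcoefB subr_eq0 => /eqP.
move=> /cellP YZ; split=> // i j; change (labs R (Y i j - Z i j) < r).
rewrite labs_lt_expR_ceil//; apply/labs_ltP => l kl.
by rewrite lcoefB YZ ?subrr.
Qed.

Lemma cell_ball (R : realType) k Y :
  cell (k, mxpart k Y) = ball Y (expR k%:~R : R).
Proof. by rewrite ball_cell ?expR_gt0// expRK intrKceil. Qed.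

Lemma open_cell (R : realType) i : open (cell i).
Proof.
case: i => k P; rewrite openE => Y /= YP.
apply/nbhs_ballP; exists (expR k%:~R : R); first exact: expR_gt0.
by rewrite -cell_ball YP.
Qed.

Lemma open_cell_nbhs (R : realType) (U : set Mat) Y : nbhs Y U ->
  exists k, cell (k, mxpart k Y) `<=` U.
Proof.
move=> /(@nbhs_ballP R)[e /= e0]; rewrite ball_cell// => YU.
by exists (Num.ceil (ln e)).
Qed.

(** A common point is a centre of both cells, and agreement down to the lower degree implies
    agreement down to the higher one. *)
Lemma cell_nested i j :
  [\/ cell i `&` cell j = set0, cell i `<=` cell j | cell j `<=` cell i].
Proof.
have [->|/set0P[Y [Yi Yj]]] := eqVneq (cell i `&` cell j) set0; first exact: Or31.
case: i j Yi Yj => [k P] [l Q]; rewrite /cell/= => <- <-.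
have [kl|lk] := leP k l; [apply: Or32|apply: Or33];
  move=> Z /cellP YZ; apply/cellP => a b c lc; apply: YZ.
- exact: le_trans lc.
- exact: le_trans (ltW lk) lc.
Qed.

End Cells.

(** * Null sets and supports of Borel measures *)

Section BorelMeasures.
Variables (R : realType) (K : finFieldType) (m n : nat).
Local Notation F := (laurent K).
Local Notation Mat := 'M[F]_(m, n).
Variable mu : {measure set (borel Mat) -> \bar R}.

Lemma measurable_open (U : set Mat) : open U -> measurable (U : set (borel Mat)).
Proof. exact: sub_sigma_algebra. Qed.

Lemma measurable_cell i : measurable (cell i : set (borel Mat)).
Proof. apply: measurable_open; exact: open_cell. Qed.

(** A Lindelof argument: the negligible traces of [A] on cells cover it, and there are countably
    many cells. *)
Lemma negligible_locally (A : set Mat) :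
  (forall Y, A Y -> exists i, cell i Y /\ mu.-negligible (A `&` cell i)) ->
  mu.-negligible A.
Proof.
move=> Aloc.
pose N k : set (borel Mat) := if unpickle k is Some i then
  (if `[< mu.-negligible (A `&` cell i) >] then A `&` cell i else set0) else set0.
have : mu.-negligible (\bigcup_k N k).
  apply: negligible_bigcup => k; rewrite /N; case: unpickle => [i|];
    last exact: negligible_set0.
  by case: asboolP => // _; exact: negligible_set0.
apply: negligibleS => Y AY; have [i [iY Ai]] := Aloc Y AY.
exists (pickle i); [exact: I|rewrite /N pickleK (asboolT Ai)].
by split; [exact: AY|exact: iY].
Qed.

(** The complement is a possibly uncountable union of open null sets; [negligible_locally] reduces
    it to cells. *)
Lemma measure_msupportC : mu (~` msupport mu) = 0%E.
Proof.
have oS : open (~` msupport mu).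
  rewrite /msupport setC_bigcap; apply: bigcup_open => C [cC _].
  by rewrite openC.
apply: measure_negligible; first exact: measurable_open.
apply: negligible_locally => Y; rewrite {1}/msupport setC_bigcap => -[C [cC C0] CY].
have [|k kC] := @open_cell_nbhs _ _ _ R (~` C) Y.
  by apply: open_nbhs_nbhs; split => //; rewrite openC.
exists (k, mxpart k Y); split=> //.
exists (~` C); split => //; first by apply: measurable_open; rewrite openC.
by move=> Z [_ /kC].
Qed.

End BorelMeasures.

(** * Norms of vectors and of polynomial vectors *)

Section Supnorm.
Variables (R : realType) (K : fieldType) (m n : nat).
Local Notation F := (laurent K).

Lemma labs_le_supnorm k (y : 'cV[F]_k) i : labs R (y i 0) <= supnorm R y.
Proof. exact: (le_bigmax _ (fun i => labs R (y i 0))). Qed.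

Lemma supnorm_ge0 k (y : 'cV[F]_k) : 0 <= supnorm R y.
Proof. exact: bigmax_ge_id. Qed.

Lemma supnorm_le k (y : 'cV[F]_k) (e : R) : 0 <= e ->
  (forall i, labs R (y i 0) <= e) -> supnorm R y <= e.
Proof. by move=> e0 ye; apply/bigmax_leP; split. Qed.

Lemma supnorm_lt k (y : 'cV[F]_k) (e : R) : 0 < e ->
  (forall i, labs R (y i 0) < e) -> supnorm R y < e.
Proof. by move=> e0 ye; apply/bigmax_ltP; split. Qed.

Lemma labs_mulmx_lt (A : 'M[F]_(m, n)) (b : 'cV[F]_n) (e M : R) j : 0 < e -> 0 < M ->
  (forall i, labs R (A j i) < e) -> (forall i, labs R (b i 0) <= M) ->
  labs R ((A *m b) j 0) < e * M.
Proof.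
move=> e0 M0 Ae bM; rewrite mxE; apply: labs_sum_lt; first exact: mulr_gt0.
move=> i _; rewrite labsM; apply: (@le_lt_trans _ _ (labs R (A j i) * M)).
  by rewrite ler_wpM2l ?labs_ge0.
by rewrite ltr_pM2r.
Qed.

Lemma lpolyvE k (q : 'cV[{poly K}]_k) i : (lpolyv q) i 0 = lpoly (q i 0%R).
Proof. by rewrite mxE. Qed.

(** Divided by X^s, the vector has norm exactly 1, as the contraction property requires of [b]. *)
Lemma supnorm_lpolyv k (q : 'cV[{poly K}]_k) : q != 0 ->
  exists s : nat, (forall i, labs R (lpoly (q i 0%R)) <= expR s%:R) /\
    exists i, labs R (lpoly (q i 0%R)) = expR s%:R.
Proof.
move=> /cV0Pn[i0 qi0].
have [i im] : {i | \max_j size (q j 0%R) = size (q i 0%R)}.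
  have [|i im] := @eq_bigmax_cond 'I_k predT (fun j => size (q j 0%R)).
    by rewrite card_ord; case: i0 {qi0}; case: k q.
  by exists i.
have sizeq j : (size (q j 0%R) <= size (q i 0%R))%N.
  by rewrite -im (leq_bigmax (F := fun j => size (q j 0%R))).
have qi : q i 0 != 0.
  by rewrite -size_poly_gt0 (leq_trans _ (sizeq i0))// size_poly_gt0.
exists (size (q i 0%R)).-1; split; last by exists i; rewrite labs_lpoly.
move=> j; have [->|qj] := eqVneq (q j 0%R) 0.
  by rewrite rmorph0 labs0 expR_ge0.
rewrite labs_lpoly// ler_expR ler_nat -!subn1 leq_sub2r//.
Qed.

Lemma supnorm_lpolyv_ge1 k (q : 'cV[{poly K}]_k) : q != 0 -> 1 <= supnorm R (lpolyv q).
Proof.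
move=> /cV0Pn[i qi]; apply: le_trans (labs_le_supnorm _ i).
by rewrite lpolyvE labs_lpoly_ge1.
Qed.

End Supnorm.

(** * Openness of the neighbourhoods of affine subspaces *)

Section OpenAffine.
Variables (R : realType) (K : finFieldType) (m n : nat).
Local Notation F := (laurent K).
Local Notation Mat := 'M[F]_(m, n).

Lemma open_affine (P : pred 'I_m) (b : 'cV[F]_n) (c : 'cV[F]_m) (eps : 'I_m -> R) :
  open [set Y : Mat | forall j, P j -> labs R ((Y *m b) j 0 + c j 0) < eps j].
Proof.
rewrite openE => Y Yeps.
(* The default 1 covers the case where no coordinate is constrained. *)
pose d := \big[Num.min/1]_(j | P j) eps j.
have d0 : 0 < d.
  by apply/bigmin_gtP; split=> // j /Yeps; apply: le_lt_trans; exact: labs_ge0.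
have de j : P j -> d <= eps j by move=> Pj; exact: bigmin_le_cond.
(* Adding 1 keeps [M] positive when [b] is zero. *)
pose M := supnorm R b + 1.
have M0 : 0 < M by rewrite ltr_wpDl ?supnorm_ge0.
apply/nbhs_ballP; exists (d / M) => /=; first by rewrite divr_gt0.
move=> Z [_ YZ] j Pj.
have -> : (Z *m b) j 0 + c j 0 = ((Y *m b) j 0 + c j 0) - ((Y - Z) *m b) j 0.
  by rewrite mulmxBl !mxE; ring.
apply: labsB_lt; first exact: Yeps.
apply: lt_le_trans (de _ Pj); rewrite -(divfK (lt0r_neq0 M0) d).
apply: labs_mulmx_lt => //; first by rewrite divr_gt0.
  by move=> i; rewrite !mxE; exact: YZ.
by move=> i; rewrite (le_trans (labs_le_supnorm _ _ _))// lerDl.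
Qed.

Lemma measurable_affine_nbhd (b : 'cV[F]_n) (c : 'cV[F]_m) (eps : 'I_m -> R) :
  measurable (affine_nbhd b c eps : set (borel Mat)).
Proof.
apply: measurable_open.
rewrite (_ : affine_nbhd b c eps = [set Y : Mat | forall j, predT j ->
  labs R ((Y *m b) j 0 + c j 0) < eps j]); first exact: open_affine.
by apply/seteqP; split=> Y /= Yeps j; move=> *; exact: Yeps.
Qed.

End OpenAffine.

(** * Uniqueness of inhomogeneous solutions *)

Section Approximation.
Variables (R : realType) (K : finFieldType) (m n : nat) (theta : 'cV[laurent K]_m).
Local Notation F := (laurent K).
Local Notation Mat := 'M[F]_(m, n).
Local Notation shape := ({ffun 'I_m -> nat} * {ffun 'I_n -> nat})%type.
Implicit Types (Y : Mat) (tau : shape).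

(** A shape lists in [tau.1] the exponents of the forms and in [tau.2] the degree bounds of [q]; [w]
    is the additional smallness measured by the contraction property. *)
Definition small_form (w : nat) tau (p : 'cV[{poly K}]_m) (q : 'cV[{poly K}]_n) : set Mat :=
  [set Y | forall j, (0 < tau.1 j)%N ->
    labs R ((Y *m lpolyv q + lpolyv p + theta) j 0) < expR (- (tau.1 j + w)%:R)].

(* The coordinates with [tau.1 j = 0] are unconstrained in [small_form], so [p j]
   is normalised there for the sake of [small_form_inj]. *)
Definition admissible tau (p : 'cV[{poly K}]_m) (q : 'cV[{poly K}]_n) :=
  [/\ q != 0, forall i, (size (q i 0%R) <= (tau.2 i).+1)%N &
      forall j, tau.1 j = 0%N -> p j 0 = 0].

(** Unlike in [small_form], a coordinate with [tau.1 j = 0] asks for a value below 1, which a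
    suitable [p j] always provides. *)
Definition hom_set tau : set Mat :=
  [set Y | exists (p : 'cV[{poly K}]_m) (q : 'cV[{poly K}]_n),
    [/\ q != 0, forall i, (size (q i 0%R) <= (tau.2 i).+1)%N &
     forall j, labs R ((Y *m lpolyv q + lpolyv p) j 0) < expR (- (tau.1 j)%:R)]].

Lemma open_small_form w tau p q : open (small_form w tau p q).
Proof.
rewrite (_ : small_form w tau p q = [set Y : Mat | forall j, (0 < tau.1 j)%N ->
  labs R ((Y *m lpolyv q) j 0 + (lpolyv p + theta) j 0) < expR (- (tau.1 j + w)%:R)]).
  exact: open_affine.
have E Y j : (Y *m lpolyv q + lpolyv p + theta) j 0 =
    (Y *m lpolyv q) j 0 + (lpolyv p + theta) j 0 by rewrite -addrA mxE.
by apply/seteqP; split=> Y Yw j uj; have := Yw j uj; rewrite E.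
Qed.

Lemma open_hom_set tau : open (hom_set tau).
Proof.
rewrite (_ : hom_set tau = \bigcup_(pq in [set pq : 'cV[{poly K}]_m * 'cV[{poly K}]_n |
    pq.2 != 0 /\ forall i, (size (pq.2 i 0%R) <= (tau.2 i).+1)%N])
  [set Y : Mat | forall j, predT j ->
    labs R ((Y *m lpolyv pq.2) j 0 + (lpolyv pq.1) j 0) < expR (- (tau.1 j)%:R)]).
  by apply: bigcup_open => pq _; exact: open_affine.
apply/seteqP; split=> Y.
  move=> [p [q [q0 qs Yq]]]; exists (p, q) => //= j _; have := Yq j.
  by rewrite mxE.
move=> [[p q] [/= q0 qs] Yq]; exists p, q; split=> // j; rewrite mxE.
exact: Yq.
Qed.

Lemma small_formS w tau p q : small_form w tau p q `<=` small_form 0 tau p q.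
Proof.
move=> Y Yw j uj; apply: lt_le_trans (Yw j uj) _.
by rewrite ler_expR lerN2 ler_nat addn0 leq_addr.
Qed.

(** If [q] and [q'] differed, the difference of the two solutions, corrected by polynomials at the
    unconstrained coordinates, would put [Y] in [hom_set tau]. *)
Lemma small_form_inj tau p q p' q' Y : ~ hom_set tau Y ->
  admissible tau p q -> admissible tau p' q' ->
  small_form 0 tau p q Y -> small_form 0 tau p' q' Y -> p = p' /\ q = q'.
Proof.
move=> nH [q0 qs p0] [q'0 q's p'0] Yp Yp'.
have sub j : (Y *m lpolyv (q - q') + lpolyv (p - p')) j 0 =
  (Y *m lpolyv q + lpolyv p + theta) j 0 - (Y *m lpolyv q' + lpolyv p' + theta) j 0.
  rewrite /lpolyv !map_mxB mulmxBr !mxE; ring.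
have small j : (0 < tau.1 j)%N ->
    labs R ((Y *m lpolyv (q - q') + lpolyv (p - p')) j 0) < expR (- (tau.1 j)%:R).
  by move=> uj; rewrite sub labsB_lt//; [have := Yp j uj|have := Yp' j uj]; rewrite addn0.
have qq' : q = q'.
  apply/eqP; rewrite -subr_eq0; apply: contrapT => /negP qq'; apply: nH.
  pose e j := sval (cid (labs_addpoly_lt1 R ((Y *m lpolyv (q - q')) j 0))).
  exists (\col_j if tau.1 j == 0%N then e j else (p - p') j 0), (q - q').
  split=> //.
    move=> i; rewrite !mxE (leq_trans (size_polyD _ _))// size_polyN geq_max.
    by rewrite qs q's.
  move=> j; have [uj|] := posnP (tau.1 j).
    rewrite mxE lpolyvE mxE uj eqxx mulr0n oppr0 expR0.
    by rewrite /e; case: cid.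
  move=> uj; have := small j uj.
  by rewrite !mxE (gtn_eqF uj).
split=> //; apply/matrixP => j z; rewrite (ord1 z) {z}.
have [uj|uj] := posnP (tau.1 j); first by rewrite p0// p'0.
(* Once q = q', the difference of the forms is the polynomial [p j - p' j]; being below 1 it
   vanishes. *)
have := small j uj; rewrite qq' subrr /lpolyv map_mx0 mulmx0 add0r -/(lpolyv _).
rewrite lpolyvE => pp'; apply/eqP; rewrite -subr_eq0.
have := @labs_lpoly_lt1 R K ((p - p') j 0); rewrite !mxE => -> //.
move: pp'; rewrite !mxE => /lt_le_trans; apply.
by rewrite -[leRHS]expR0 ler_expR oppr_le0.
Qed.

End Approximation.

(** Summability for the Borel-Cantelli lemma: half of the decay absorbs the polynomial number of
    shapes, and the other half leaves a geometric series. *)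
Lemma poly_expR_bound (R : realType) (A k : nat) (a : R) : 0 < a ->
  exists2 M : R, 0 <= M & forall t : nat,
    (A * t.+1 ^ k)%:R * expR (- t%:R) `^ a <= geometric M (expR (- (a / 2))) t.
Proof.
(* Chosen so that k b <= a / 2, also for k = 0; then t + 1 <= (1 + 1/b) e^(b t), because 1 + x <=
   e^x. *)
move=> a0; pose b := a / 2 / k.+1%:R.
have b0 : 0 < b by rewrite !divr_gt0.
pose D := 1 + b^-1.
have D1 : 1 <= D by rewrite lerDl invr_ge0 ltW.
exists (A%:R * D ^+ k); first by rewrite mulr_ge0// exprn_ge0// (le_trans ler01).
move=> t; rewrite /= -expRM_natl /powR gt_eqF ?expR_gt0// expRK natrM natrX.
have tD : t.+1%:R <= D * expR (b * t%:R).
  apply: (@le_trans _ _ (D * (1 + b * t%:R))).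
    rewrite -natr1 /D; have b1 := mulVf (lt0r_neq0 b0).
    have : 0 <= b^-1 by rewrite invr_ge0 ltW.
    have : 0 <= b * t%:R by rewrite mulr_ge0// ltW.
    nra.
  by rewrite ler_pM2l ?expR_ge1Dx// (lt_le_trans ltr01).
have bk : b * t%:R * k%:R <= t%:R * (a / 2).
  have bk' : b * k%:R <= a / 2.
    rewrite -[leRHS](divfK (_ : k.+1%:R != 0)) ?pnatr_eq0//.
    by rewrite ler_wpM2l ?(ltW b0)// ler_nat.
  by rewrite mulrAC mulrC ler_wpM2l.
apply: (@le_trans _ _ (A%:R * (D ^+ k * expR (t%:R * (a / 2))) * expR (a * - t%:R))).
  rewrite ler_wpM2r ?expR_ge0// ler_wpM2l//.
  apply: (@le_trans _ _ ((D * expR (b * t%:R)) ^+ k)).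
    by rewrite lerXn2r// nnegrE ?ler0n// mulr_ge0 ?expR_ge0// (le_trans ler01).
  rewrite exprMn ler_wpM2l ?exprn_ge0// ?(le_trans ler01)//.
  by rewrite -expRM_natr ler_expR.
have -> : t%:R * - (a / 2) = t%:R * (a / 2) + a * - t%:R by field.
by rewrite expRD !mulrA.
Qed.

(** * The transference estimate *)

Section Transference.
Variables (R : realType) (K : finFieldType) (m n : nat) (theta : 'cV[laurent K]_m).
Local Notation F := (laurent K).
Local Notation Mat := 'M[F]_(m, n).
Local Notation shape := ({ffun 'I_m -> nat} * {ffun 'I_n -> nat})%type.
Implicit Types (Y : Mat) (tau : shape).
Variable mu : {measure set (borel Mat) -> \bar R}.

Lemma measurable_ball Y (r : R) : 0 < r -> measurable (ball Y r : set (borel Mat)).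
Proof. by move=> r0; rewrite ball_cell//; exact: measurable_cell. Qed.

(** Three doublings suffice, since 5 <= 2^3. *)
Lemma doubling_ball5 (c : R) : 0 < c ->
  (forall (Y : Mat) (r : R), msupport mu Y -> 0 < r ->
    (mu (ball Y (2 * r)) <= c%:E * mu (ball Y r))%E) ->
  forall (Y : Mat) (r : R), msupport mu Y -> 0 < r ->
    (mu (ball Y (5 * r)) <= (c ^+ 3)%:E * mu (ball Y r))%E.
Proof.
move=> c0 dbl Y r SY r0.
apply: (@le_trans _ _ (mu (ball Y (2 * (2 * (2 * r)))))).
  apply: le_measure; rewrite ?inE; [| |by apply: le_ball; lra];
  by apply: measurable_ball; rewrite ?mulr_gt0.
apply: (le_trans (dbl _ _ SY _)); first by rewrite ?mulr_gt0.
rewrite exprS EFinM -muleA lee_pmul2l ?lte_fin//.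
apply: (le_trans (dbl _ _ SY _)); first by rewrite ?mulr_gt0.
rewrite exprS expr1 EFinM -muleA lee_pmul2l ?lte_fin//.
exact: dbl.
Qed.

(* Off [hom_set tau] the pair (p, q) is determined by Y, hence constant on the trace of
   [W] on each contracting ball, where the contraction inequality applies to it. The
   unconstrained coordinates get a bound eps_j = M so large that it always holds on the
   ball of radius [rho]. *)
Lemma small_form_measure (E : set ('I_m -> R)) (C alpha r0 c rho : R) (w : nat) tau
    (W : set Mat) :
  0 < C -> 0 < c -> 0 < rho -> (0 < w)%N ->
  (forall (b : 'cV[F]_n) (c : 'cV[F]_m) (eps : 'I_m -> R) (delta : R),
    supnorm R b = 1 -> E eps -> (forall j, 0 < eps j) ->
    (exists j, eps j < r0) -> 0 < delta < 1 ->
    let L := affine_nbhd b c eps in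
    let Ldelta := affine_nbhd b c (fun j => delta * eps j) in
    forall Y : Mat, (Ldelta `&` msupport mu) Y ->
      exists2 r : R, 0 < r &
        ball Y r `&` msupport mu `<=` L /\
        (mu (ball Y (5 * r) `&` Ldelta)
           <= (C * delta `^ alpha)%:E * mu (ball Y (5 * r)))%E) ->
  (forall (Y : Mat) (r : R), msupport mu Y -> 0 < r ->
    (mu (ball Y (2 * r)) <= c%:E * mu (ball Y r))%E) ->
  (exists2 j, (0 < tau.1 j)%N & expR (- (tau.1 j)%:R) < r0) ->
  (forall M s : R, 0 < M ->
    E (fun j => if tau.1 j == 0%N then M else expR (- (tau.1 j)%:R - s))) ->
  measurable (W : set (borel Mat)) ->
  (forall Y, W Y -> [/\ ball (0 : Mat) rho Y, ~ hom_set R tau Y &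
    exists p q, admissible tau p q /\ small_form R theta w tau p q Y]) ->
  (mu W <= (C * expR (- w%:R) `^ alpha * c ^+ 3)%:E * mu setT)%E.
Proof.
move=> C0 c0 rho0 w0 contr dbl [j0 uj0 uj0r0] EM mW Wprop.
set kap := C * _ * _.
have kap0 : 0 <= kap by rewrite !mulr_ge0 ?powR_ge0 ?exprn_ge0// ltW.
have mS : measurable (~` msupport mu : set (borel Mat)).
  apply: measurable_open; rewrite /msupport setC_bigcap; apply: bigcup_open.
  by move=> A [cA _]; rewrite openC.
have mS' : measurable (msupport mu : set (borel Mat)).
  by rewrite -[msupport mu]setCK; exact: measurableC.
have muS (A : set (borel Mat)) : measurable A -> mu A = mu (A `&` msupport mu).
  move=> mA; rewrite (measureDI mu mA mS') [X in (X + _)%E](_ : _ = 0%E) ?add0e//.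
  apply/eqP; rewrite -measure_le0 -(measure_msupportC mu).
  by apply: le_measure; rewrite ?inE//; exact: measurableD.
(* The cells in which [W] has proportion at most [kap]; the next claim is that they cover [W] within
   the support. *)
pose D := [set i | (mu (W `&` cell i) <= kap%:E * mu (cell i))%E].
have WD : W `&` msupport mu `<=` \bigcup_(i in D) cell i.
  move=> Y [WY SY]; have [Yrho nH [p [q [adm Ypq]]]] := Wprop _ WY.
  have [q0 qs p0] := adm.
  have [s [qle [i0 qi0]]] := supnorm_lpolyv R q0.
  (* Scaling by X^-s gives [b] norm 1 and multiplies every form by e^-s, which explains the s in
     [eps]. *)
  pose a : F := lX K ^ (- s%:Z).
  have aE : labs R a = expR (- s%:R) by rewrite labs_lXz mulrNz.
  pose b := a *: lpolyv q; pose d := a *: (lpolyv p + theta).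
  have form Z j : labs R ((Z *m b) j 0 + d j 0) =
      expR (- s%:R) * labs R ((Z *m lpolyv q + lpolyv p + theta) j 0).
    rewrite -aE -labsM; congr (labs R _); rewrite /b /d -scalemxAr.
    by rewrite -addrA !mxE; ring.
  have b_le i : labs R (b i 0) <= 1.
    rewrite mxE labsM aE lpolyvE -[leRHS]expR0 -(addNr s%:R) expRD.
    by rewrite ler_wpM2l// expR_ge0.
  have b1 : supnorm R b = 1.
    apply/eqP; rewrite eq_le supnorm_le//=; apply: le_trans (labs_le_supnorm R b i0).
    by rewrite mxE labsM aE lpolyvE qi0 -expRD addNr expR0.
  (* The factor [expR w%:R] cancels [delta], so that the shrunken bound is still rho + |d|. *)
  pose M := expR w%:R * (rho + supnorm R d).
  have M0 : 0 < M by rewrite mulr_gt0 ?expR_gt0// ltr_wpDr ?supnorm_ge0.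
  pose eps j := if tau.1 j == 0%N then M else expR (- (tau.1 j)%:R - s%:R).
  pose delta : R := expR (- w%:R).
  have eps0 j : 0 < eps j by rewrite /eps; case: ifP => // _; exact: expR_gt0.
  have epsr0 : exists j, eps j < r0.
    exists j0; rewrite /eps gtn_eqF//; apply: le_lt_trans uj0r0.
    by rewrite ler_expR gerDl oppr_le0.
  have delta01 : 0 < delta < 1.
    by rewrite expR_gt0 -expR0 ltr_expR oppr_lt0 ltr0n.
  have LdeltaP Z : ball (0 : Mat) rho Z -> small_form R theta w tau p q Z ->
      affine_nbhd b d (fun j => delta * eps j) Z.
    move=> [_ Zrho] Zw j; rewrite /eps; case: eqP => [uj|/eqP]; last first.
      rewrite -lt0n => uj; rewrite form -expRD.
      rewrite (_ : - w%:R + _ = - s%:R + - (tau.1 j + w)%:R); last by rewrite natrD; ring.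
      by rewrite expRD ltr_pM2l ?expR_gt0// Zw.
    rewrite mulrA -expRD addNr expR0 mul1r.
    apply: le_lt_trans (labsD R _ _) _; rewrite gt_max; apply/andP; split.
      apply: (@lt_le_trans _ _ rho); last by rewrite lerDl supnorm_ge0.
      rewrite -[rho]mulr1; apply: labs_mulmx_lt => // i.
      have : labs R ((0 : Mat) j i - Z j i) < rho := Zrho j i.
      by rewrite mxE sub0r labsN.
    apply: le_lt_trans (labs_le_supnorm R d j) _.
    by rewrite ltrDr.
  have [|r r_gt0 [BL muB]] := contr b d eps delta b1 (EM _ _ M0) eps0 epsr0 delta01 Y.
    by split=> //; exact: LdeltaP.
  exists (Num.ceil (ln r), mxpart (Num.ceil (ln r)) Y); last first.
    by rewrite -ball_cell//; exact: ballxx.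
  rewrite /D /= -ball_cell//.
  rewrite muS; last by apply: measurableI => //; exact: measurable_ball.
  apply: (@le_trans _ _ (mu (ball Y (5 * r) `&` affine_nbhd b d (fun j => delta * eps j)))).
    apply: le_measure; rewrite ?inE.
    - by apply: measurableI => //; apply: measurableI => //; exact: measurable_ball.
    - apply: measurableI; last exact: measurable_affine_nbhd.
      by apply: measurable_ball; rewrite mulr_gt0.
    move=> Z [[WZ YZ] SZ]; split.
      by move: YZ; apply: le_ball; lra.
    have [Zrho nHZ [p' [q' [adm' Zpq']]]] := Wprop _ WZ.
    (* Membership in [L] gives the inequalities for (p, q) without the factor e^-w. By uniqueness
       the pair of [Z] is (p, q), and its stronger inequalities put [Z] in the shrunken
       neighbourhood. *)
    have Zpq : small_form R theta 0 tau p q Z.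
      move=> j uj; have := BL Z (conj YZ SZ) j; rewrite form /eps gtn_eqF//.
      rewrite (_ : expR (_ - _) = expR (- s%:R) * expR (- (tau.1 j)%:R)).
        by rewrite ltr_pM2l ?expR_gt0// addn0.
      by rewrite -expRD addrC.
    have [? ?] := small_form_inj nHZ adm adm' Zpq (small_formS Zpq').
    by subst p' q'; exact: LdeltaP.
  apply: le_trans muB _; rewrite /kap [X in (_ <= X * _)%E]EFinM -muleA.
  apply: lee_wpmul2l; first by rewrite lee_fin mulr_ge0 ?powR_ge0// ltW.
  exact: doubling_ball5.
rewrite muS//.
have mU : measurable (\bigcup_(i in D) cell i : set (borel Mat)).
  by apply: measurable_open; apply: bigcup_open => i _; exact: open_cell.
(* Laminarity passes the bound from single cells to their union, comparing the restriction of [mu]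
   to [W] with [kap] times [mu]. *)
apply: (@le_trans _ _ (mrestr mu mW (\bigcup_(i in D) cell i))).
  apply: le_measure; rewrite ?inE; [exact: measurableI|exact: measurableI|].
  by move=> Y [WY SY]; split=> //; exact: WD.
apply: (@le_trans _ _ (mscale (NngNum kap0) mu (\bigcup_(i in D) cell i))).
  apply: laminar_bigcup_le => [i|i j|i].
  - exact: measurable_cell.
  - exact: cell_nested.
  - by rewrite /D /= /mrestr /mscale /= setIC.
rewrite /mscale /=; apply: lee_wpmul2l; first by rewrite lee_fin.
by apply: le_measure; rewrite ?inE.
Qed.

Lemma measure_bigsetU_le (I : Type) (s : seq I) (f : I -> set (borel Mat)) (k : R) :
  (forall i, measurable (f i)) -> (forall i, (mu (f i) <= k%:E)%E) ->
  (mu (\big[setU/set0]_(i <- s) f i) <= ((size s)%:R * k)%:E)%E.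
Proof.
move=> mf fk; elim: s => [|i s IH]; first by rewrite big_nil measure0 mul0r.
rewrite big_cons /= -add1n natrD mulrDl mul1r EFinD.
apply: (@le_trans _ _ (mu (f i) + mu (\big[setU/set0]_(j <- s) f j))%E).
  by apply: measureU2 => //; exact: bigsetU_measurable.
exact: leeD.
Qed.

(** Borel-Cantelli on pieces: a piece fixes a time [t0] from which the homogeneous inequalities fail
    and a ball containing [Y]. At time t each shape contributes O(e^(-a t)), and there are
    polynomially many shapes. *)
Lemma small_form_limsup_negligible (E : set ('I_m -> R)) (P : nat -> seq shape)
    (A k N : nat) :
  contracting_for E mu ->
  (forall t tau, (N <= t)%N -> tau \in P t -> exists j, (t <= tau.1 j)%N) ->
  (forall t tau (M s : R), (N <= t)%N -> tau \in P t -> 0 < M ->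
    E (fun j => if tau.1 j == 0%N then M else expR (- (tau.1 j)%:R - s))) ->
  (forall t, (size (P t) <= A * t.+1 ^ k)%N) ->
  mu.-negligible [set Y | forall t0, exists t tau,
    [/\ (t0 <= t)%N, tau \in P t & hom_set R tau Y]] ->
  mu.-negligible [set Y | forall t0, exists t tau p q,
    [/\ (t0 <= t)%N, tau \in P t, admissible tau p q & small_form R theta t tau p q Y]].
Proof.
move=> [muoo _ [c c0 dbl] [C [a [r0 [C0 a0 r0_gt0 contr]]]]] Pbig PE Psize negH.
have mufin : mu setT \is a fin_num by rewrite ge0_fin_numE.
pose H (t0 : nat) : set Mat := \bigcup_(t in [set t | (t0 <= t)%N])
  \bigcup_(tau in [set` P t]) hom_set R tau.
have oH t0 : open (H t0).
  by apply: bigcup_open => t _; apply: bigcup_open => tau _; exact: open_hom_set.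
pose U t tau : set Mat := \bigcup_(pq in [set pq : 'cV[{poly K}]_m * 'cV[{poly K}]_n |
  admissible tau pq.1 pq.2]) small_form R theta t tau pq.1 pq.2.
have oU t tau : open (U t tau) by apply: bigcup_open => pq _; exact: open_small_form.
(* The successor of [N] makes t positive, as the factor e^-t has to be below 1; the other term gives
   e^-t < r0. *)
pose N1 := maxn N.+1 (Num.truncn (- ln r0)).+1.
have N1r0 t : (N1 <= t)%N -> expR (- t%:R) < r0.
  move=> Nt; rewrite -[ltRHS]lnK// ltr_expR ltrNl.
  apply: (@lt_le_trans _ _ (Num.truncn (- ln r0)).+1%:R); first exact: truncnS_gt.
  by rewrite ler_nat (leq_trans _ Nt)// leq_maxr.
(* Empty at early times and off [P t], so that the bound [muW] holds for all indices. *)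
pose W (t0 rho t : nat) tau : set (borel Mat) :=
  if (t0 <= t)%N && (N1 <= t)%N && (tau \in P t) then
    ball (0 : Mat) (rho.+1%:R : R) `&` ~` H t0 `&` U t tau else set0.
have mW t0 rho t tau : measurable (W t0 rho t tau).
  rewrite /W; case: ifP => // _; apply: measurableI; last exact: measurable_open.
  apply: measurableI; first exact: measurable_ball.
  by apply: measurableC; exact: measurable_open.
pose kap t := C * expR (- t%:R) `^ a * c ^+ 3.
have muW t0 rho t tau : (mu (W t0 rho t tau) <= (kap t * fine (mu setT))%:E)%E.
  rewrite EFinM fineK// /W; case: ifP => [/andP[/andP[t0t Nt] tauP]|_]; last first.
    rewrite measure0 mule_ge0// lee_fin /kap !mulr_ge0 ?powR_ge0 ?exprn_ge0 ?(ltW c0)//.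
    exact: ltW.
  have {}NNt : (N <= t)%N by rewrite (leq_trans _ Nt)// leq_max leqnSn.
  have t_gt0 : (0 < t)%N by rewrite (leq_trans _ Nt)// leq_max.
  have [j tj] := Pbig t tau NNt tauP.
  apply: (small_form_measure (r0 := r0) (rho := rho.+1%:R) (w := t) (tau := tau))
    contr dbl _ _ _ _ => //.
  - exists j; first exact: leq_trans tj.
    by apply: le_lt_trans (N1r0 t Nt); rewrite ler_expR lerN2 ler_nat.
  - by move=> M s; exact: (PE t tau M s NNt tauP).
  - by have := mW t0 rho t tau; rewrite /W t0t Nt tauP.
  move=> Y [[Yrho nH] [[p q] /= adm Ypq]]; split=> //.
    by move=> HY; apply: nH; exists t => //; exists tau.
  by exists p, q.
pose B t0 rho t : set (borel Mat) := \big[setU/set0]_(tau <- P t) W t0 rho t tau.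
have mB t0 rho t : measurable (B t0 rho t) by exact: bigsetU_measurable.
have [M M0 Mle] := poly_expR_bound A k a0.
have muB t0 rho : mu (lim_sup_set (B t0 rho)) = 0%E.
  apply: lim_sup_set_cvg0 => //.
  pose L := C * c ^+ 3 * fine (mu setT).
  have L0 : 0 <= L by rewrite !mulr_ge0 ?exprn_ge0 ?fine_ge0 ?(ltW c0) ?(ltW C0).
  have x1 : expR (- (a / 2)) < 1.
    by rewrite -expR0 ltr_expR oppr_lt0 divr_gt0.
  apply: (@le_lt_trans _ _ (M * L * (1 - expR (- (a / 2)))^-1)%:E); last exact: ltry.
  apply: lime_le; first by apply: is_cvg_nneseries => *; exact: measure_ge0.
  apply: nearW => l.
  apply: (@le_trans _ _ (series (geometric (M * L) (expR (- (a / 2)))) l)%:E).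
    rewrite /series /= -sumEFin; apply: lee_sum => t _.
    apply: le_trans (measure_bigsetU_le _ _ _) _; [exact: mW|exact: muW|].
    rewrite lee_fin [leRHS](_ : _ = geometric M (expR (- (a / 2))) t * L); last first.
      by rewrite /=; ring.
    apply: le_trans (_ : (A * t.+1 ^ k)%:R * expR (- t%:R) `^ a * L <= _); last first.
      by rewrite ler_wpM2r.
    rewrite /kap /L [leRHS](_ : _ =
      (A * t.+1 ^ k)%:R * (C * expR (- t%:R) `^ a * c ^+ 3 * fine (mu setT))); last by ring.
    rewrite ler_wpM2r ?ler_nat//.
    by rewrite !mulr_ge0 ?powR_ge0 ?exprn_ge0 ?fine_ge0 ?(ltW c0) ?(ltW C0).
  rewrite lee_fin; apply: geometric_le_lim.
  - exact: mulr_ge0.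
  - exact: expR_gt0.
  - by rewrite ger0_norm ?expR_ge0.
have neg : mu.-negligible (\bigcup_t0 \bigcup_rho lim_sup_set (B t0 rho)).
  apply: negligible_bigcup => t0; apply: negligible_bigcup => rho.
  have mL : measurable (lim_sup_set (B t0 rho)).
    by apply: bigcapT_measurable => l; apply: bigcup_measurable.
  by apply/(negligibleP _ mL); exact: muB.
apply: negligibleS (negligibleU negH neg) => Y Ylim.
(* Either the homogeneous inequalities recur for ever, a null event by hypothesis, or they stop at
   some [t0] and [Y] lies in a piece. *)
have [HY|HY] := pselect (forall t0, H t0 Y).
  left => t0; have [t /= t0t [tau tauP Ht]] := HY t0.
  by exists t, tau.
right; have /existsNP[t0 nHt0] := HY; exists t0 => //.
have [rho Yrho] : exists rho : nat, ball (0 : Mat) (rho.+1%:R : R) Y.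
  pose S := \sum_i \sum_j labs R (Y i j).
  have S0 : 0 <= S by rewrite sumr_ge0// => i _; rewrite sumr_ge0// => j _; exact: labs_ge0.
  exists (Num.truncn S); split=> // i j.
  change (labs R ((0 : Mat) i j - Y i j) < (Num.truncn S).+1%:R).
  rewrite mxE sub0r labsN; apply: le_lt_trans (truncnS_gt S).
  rewrite /S (bigD1 i)//= (bigD1 j)//= -!addrA lerDl addr_ge0 ?sumr_ge0//.
    by move=> *; exact: labs_ge0.
  by move=> *; rewrite sumr_ge0// => *; exact: labs_ge0.
exists rho => // l _.
have [t [tau [p [q [lt tauP adm Ypq]]]]] := Ylim (maxn l (maxn t0 N1)).
move: lt; rewrite geq_max => /andP[lt]; rewrite geq_max => /andP[t0t Nt].
exists t => //; rewrite /B -bigcup_seq; exists tau => //.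
by rewrite /W t0t Nt tauP; split=> //; exists (p, q).
Qed.

End Transference.

(** * The lower bound *)

Section InhomogeneousDirichlet.
Variables (R : realType) (K : finFieldType) (m n : nat) (Y : 'M[laurent K]_(m, n)).
Local Notation F := (laurent K).
Implicit Types (x y : 'cV[F]_m) (l : int) (b : nat).

Lemma size_colB (q q' : 'cV[{poly K}]_n) i b :
  (size (q i 0%R) <= b)%N -> (size (q' i 0%R) <= b)%N -> (size ((q - q')%R i 0%R) <= b)%N.
Proof.
by move=> qb q'b; rewrite !mxE (leq_trans (size_polyD _ _))// size_polyN geq_max qb.
Qed.

(** For fixed l and b these x form a vector space over the constants K; multiplication by X raises
    both l and b by one. *)
Definition approximable l b x := exists (p : 'cV[{poly K}]_m) (q : 'cV[{poly K}]_n),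
  (forall i, (size (q i 0%R) <= b)%N) /\
  forall j, labs R ((Y *m lpolyv q + lpolyv p + x) j 0) < expR l%:~R.

Lemma approximableZ l b (c : K) x y : approximable l b x -> approximable l b y ->
  approximable l b (lpoly c%:P *: x + y).
Proof.
move=> [p [q [qs xs]]] [p' [q' [q's ys]]].
exists (c%:P *: p + p'), (c%:P *: q + q'); split=> [i|j].
  rewrite !mxE (leq_trans (size_polyD _ _))// geq_max q's andbT.
  by rewrite mul_polyC (leq_trans (size_scale_leq _ _)).
have -> : (Y *m lpolyv (c%:P *: q + q') + lpolyv (c%:P *: p + p') +
    (lpoly c%:P *: x + y)) j 0 =
    lpoly c%:P * (Y *m lpolyv q + lpolyv p + x) j 0 +
    (Y *m lpolyv q' + lpolyv p' + y) j 0.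
  rewrite /lpolyv !map_mxD !map_mxZ mulmxDr -scalemxAr !mxE; ring.
apply: labsD_lt => //; rewrite labsM; apply: le_lt_trans (xs j).
rewrite ler_piMl ?labs_ge0//; have [->|c0] := eqVneq c 0.
  by rewrite polyC0 rmorph0 labs0.
by rewrite labs_lpoly ?polyC_eq0// size_polyC c0 expR0.
Qed.

Lemma approximable_small l b x : (forall j, labs R (x j 0) < expR l%:~R) ->
  approximable l b x.
Proof.
move=> xl; exists 0, 0; split=> [i|j]; first by rewrite mxE size_poly0.
by rewrite /lpolyv !map_mx0 mulmx0 !add0r.
Qed.

Lemma approximable0 l b : approximable l b 0.
Proof. by apply: approximable_small => j; rewrite mxE labs0 expR_gt0. Qed.

Lemma approximableD l b x y : approximable l b x -> approximable l b y ->
  approximable l b (x + y).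
Proof. by move=> xb yb; have := approximableZ 1 xb yb; rewrite polyC1 rmorph1 scale1r. Qed.

Lemma approximableN l b x : approximable l b x -> approximable l b (- x).
Proof.
move=> xb; have := approximableZ (-1) xb (approximable0 l b).
by rewrite polyCN polyC1 rmorphN1 scaleN1r addr0.
Qed.

Lemma approximableX l b x : approximable l b x ->
  approximable (l + 1) b.+1 (lX K *: x).
Proof.
move=> [p [q [qs xs]]]; exists ('X *: p), ('X *: q); split=> [i|j].
  by rewrite mxE mulrC (leq_trans (size_polyMleq _ _))// size_polyX addnS addn1/= ltnS.
have -> : (Y *m lpolyv ('X *: q) + lpolyv ('X *: p) + lX K *: x) j 0 =
    lX K * (Y *m lpolyv q + lpolyv p + x) j 0.
  by rewrite /lpolyv !map_mxZ -scalemxAr -/(lX K) !mxE; ring.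
have -> : expR (l + 1)%:~R = expR 1 * expR l%:~R :> R.
  by rewrite intrD addrC expRD.
by rewrite labsM labs_lX ltr_pM2l ?expR_gt0.
Qed.

Lemma approximableS l l' b b' x : l <= l' -> (b <= b')%N ->
  approximable l b x -> approximable l' b' x.
Proof.
move=> ll bb [p [q [qs xs]]]; exists p, q; split=> [i|j].
  exact: leq_trans bb.
by apply: lt_le_trans (xs j) _; rewrite ler_expR ler_int.
Qed.

(* If one dilation step gains nothing, multiplication by X preserves approximability;
   as every vector is a power of X times a small one, there is nothing left to gain. *)
Lemma approximable_stable l b :
  (forall x, approximable (l + 1) b.+1 x -> approximable l b x) ->
  forall x, approximable l b x.
Proof.
move=> stable x.
have iterX k y : approximable l b y -> approximable l b (lX K ^+ k *: y).
  elim: k y => [|k IH] y yb; first by rewrite expr0 scale1r.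
  by rewrite exprSr -scalerA; apply: IH; apply: stable; exact: approximableX.
pose S := supnorm R x + 1.
have S0 : 0 < S by rewrite ltr_wpDl ?supnorm_ge0.
(* Large enough for X^-k x to have norm below e^l. *)
pose k := `|Num.ceil (ln S) - l|%N.
have -> : x = lX K ^+ k *: (lX K ^ (- k%:Z) *: x).
  by rewrite scalerA -exprnN divff ?scale1r// expf_neq0// lX_neq0.
apply: iterX; apply: approximable_small => j; rewrite mxE labsM labs_lXz.
apply: (@lt_le_trans _ _ (expR (- k%:Z)%:~R * S)).
  rewrite ltr_pM2l ?expR_gt0//; apply: le_lt_trans (labs_le_supnorm R x j) _.
  by rewrite ltrDl.
rewrite -[X in _ * X]lnK// -expRD ler_expR.
apply: (@le_trans _ _ ((- k%:Z)%:~R + (Num.ceil (ln S))%:~R)).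
  by rewrite lerD2l ceil_ge.
by rewrite -intrD ler_int /k; lia.
Qed.

(* The vectors whose coefficients are supported in the degrees -a, ..., -1. *)
Definition frac_vec (a : nat) (v : 'M[K]_(m, a)) : 'cV[F]_m :=
  \col_j (lX K ^ (- a%:Z) * lpoly (rVpoly (row j v))).

Lemma frac_vecZ a (c : K) (u v : 'M[K]_(m, a)) :
  frac_vec (c *: u + v) = lpoly c%:P *: frac_vec u + frac_vec v.
Proof.
apply/matrixP => j z; rewrite !mxE linearP /= linearP /= -mul_polyC.
by rewrite rmorphD rmorphM /=; ring.
Qed.

(** Take the polynomial part of X^a x and cut it at degree a: the low part gives the digits [v],
    while the high part is divisible by X^a and so yields a polynomial after division. *)
Lemma frac_vec_ex a x : exists (v : 'M[K]_(m, a)) (p : 'cV[{poly K}]_m),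
  forall j, labs R ((x + lpolyv p - frac_vec v) j 0) < expR (- a%:R).
Proof.
pose P j := lpart 0 (lX K ^+ a * x j 0).
exists (\matrix_j poly_rV (take_poly a (P j))), (\col_j - drop_poly a (P j)) => j.
have X0 : lX K ^+ a != 0 by rewrite expf_neq0// lX_neq0.
have -> : (x + lpolyv (\col_j - drop_poly a (P j)) -
    frac_vec (a := a) (\matrix_j poly_rV (take_poly a (P j)))) j 0 =
    lX K ^ (- a%:Z) * (lX K ^+ a * x j 0 - lpoly (P j)).
  rewrite /frac_vec !mxE rowK poly_rV_K ?size_take_poly// rmorphN /=.
  rewrite -[in RHS](poly_take_drop a (P j)) rmorphD rmorphM rmorphXn /= -/(lX K).
  by rewrite -exprnN; field.
rewrite labsM labs_lXz mulrNz -[ltRHS]mulr1 ltr_pM2l ?expR_gt0//.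
exact: labs_sub_lpart.
Qed.

Definition frac_approx l b a : {set 'M[K]_(m, a)} :=
  [set v | `[< approximable l b (frac_vec v) >]].

Lemma frac_approxP l b a (v : 'M[K]_(m, a)) :
  reflect (approximable l b (frac_vec v)) (v \in frac_approx l b a).
Proof. by rewrite finset.in_set; exact: asboolP. Qed.

(** Sending [q] to the first a fractional digits of Y q is injective: two vectors with the same
    digits would differ by a nonzero solution of the homogeneous system. *)
Lemma frac_approx_card0 (a b : nat) :
  (forall (p : 'cV[{poly K}]_m) (q : 'cV[{poly K}]_n),
    (forall i, (size (q i 0%R) <= b)%N) ->
    (forall j, labs R ((Y *m lpolyv q + lpolyv p) j 0) < expR (- a%:R)) -> q = 0) ->
  (#|K| ^ (n * b) <= #|frac_approx (- a%:Z) b a|)%N.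
Proof.
move=> nosol; rewrite -card_mx.
pose qv (Q : 'M[K]_(n, b)) : 'cV[{poly K}]_n := \col_i rVpoly (row i Q).
pose f Q := sval (cid (frac_vec_ex a (Y *m lpolyv (qv Q)))).
have fP Q : exists p : 'cV[{poly K}]_m,
    forall j, labs R ((Y *m lpolyv (qv Q) + lpolyv p - frac_vec (f Q)) j 0) < expR (- a%:R).
  by rewrite /f; case: cid.
have szq Q i : (size (qv Q i 0%R) <= b)%N by rewrite mxE size_poly.
have f_inj : injective f.
  move=> Q Q' fQ; have [p pQ] := fP Q; have [p' pQ'] := fP Q'.
  have /eqP : qv Q - qv Q' = 0.
    apply: (nosol (p - p')) => [i|j].
      exact: size_colB.
    have -> : (Y *m lpolyv (qv Q - qv Q') + lpolyv (p - p')) j 0 =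
      (Y *m lpolyv (qv Q) + lpolyv p - frac_vec (f Q)) j 0 -
      (Y *m lpolyv (qv Q') + lpolyv p' - frac_vec (f Q')) j 0.
      rewrite fQ /lpolyv !map_mxB mulmxBr; move: (map_mx _ (qv Q)) (map_mx _ (qv Q')).
      by move=> u u'; rewrite !mxE; ring.
    by apply: labsB_lt; [exact: pQ|exact: pQ'].
  rewrite subr_eq0 => /eqP QQ'; apply/row_matrixP => i.
  have := congr1 (fun M : 'cV[{poly K}]_n => M i 0) QQ'; rewrite !mxE.
  by move/(congr1 (@poly_rV K b)); rewrite !rVpolyK.
rewrite -(card_imset _ f_inj); apply: subset_leq_card; apply/fintype.subsetP => v.
move=> /imsetP[Q _ ->]; apply/frac_approxP.
have [p pQ] := fP Q; exists (- p), (- qv Q); split=> [i|j].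
  by rewrite mxE size_polyN.
have -> : (Y *m lpolyv (- qv Q) + lpolyv (- p) + frac_vec (f Q)) j 0 =
    - (Y *m lpolyv (qv Q) + lpolyv p - frac_vec (f Q)) j 0.
  rewrite /lpolyv !map_mxN mulmxN; move: (map_mx _ (qv Q)) => u.
  by rewrite !mxE; ring.
by rewrite labsN mulrNz.
Qed.

(** At precision e^l with l >= -a, only the class modulo polynomials and the digits down to degree
    -a matter. *)
Lemma approximable_frac (a : nat) l b x (v : 'M[K]_(m, a)) (p : 'cV[{poly K}]_m) :
  - a%:Z <= l ->
  (forall j, labs R ((x + lpolyv p - frac_vec v) j 0) < expR (- a%:R)) ->
  approximable l b x <-> approximable l b (frac_vec v).
Proof.
move=> al xpv.
have xv : approximable l b (x - frac_vec v).
  exists p, 0; split=> [i|j]; first by rewrite mxE size_poly0.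
  rewrite {1}/lpolyv map_mx0 mulmx0 add0r addrCA addrA.
  apply: lt_le_trans (xpv j) _; rewrite (_ : - a%:R = (- a%:Z)%:~R); last by rewrite mulrNz.
  by rewrite ler_expR ler_int.
split=> h.
  by rewrite -[frac_vec v](subKr x); exact: (approximableD h (approximableN xv)).
by rewrite -[x](subrK (frac_vec v)); exact: (approximableD xv h).
Qed.

(** Unless the space is already everything, the next one contains a new vector [v]; the sums c v +
    u, with c in K and u old, are distinct, so the dimension grows. *)
Lemma frac_approx_card_step l b a : - a%:Z <= l ->
  (forall x, approximable l b x) \/
  (#|K| * #|frac_approx l b a| <= #|frac_approx (l + 1) b.+1 a|)%N.
Proof.
move=> al; have [stable|/existsNP[x /not_implyP[xS nx]]] :=
  pselect (forall x, approximable (l + 1) b.+1 x -> approximable l b x).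
  by left; exact: approximable_stable.
right; have [v [p xpv]] := frac_vec_ex a x.
have al1 : - a%:Z <= l + 1 by rewrite (le_trans al)// lerDl.
have vS := (approximable_frac b.+1 al1 xpv).1 xS.
have nv : ~ approximable l b (frac_vec v).
  by move=> h; apply: nx; exact: (approximable_frac b al xpv).2.
pose g (cu : K * 'M[K]_(m, a)) := cu.1 *: v + cu.2.
rewrite -cardsT -cardsX -(card_in_imset (f := g)).
  apply: subset_leq_card; apply/fintype.subsetP => w /imsetP[[c u]].
  move=> /setXP[_ /frac_approxP ub] ->.
  apply/frac_approxP; rewrite /g frac_vecZ; apply: (approximableZ _ vS).
  by apply: (approximableS _ _ ub); [rewrite lerDl|exact: leqnSn].
move=> [c u] [c' u'] /setXP[_ /frac_approxP ub] /setXP[_ /frac_approxP u'b] guu'.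
have [cc'|cc'] := eqVneq c c'.
  by move: guu'; rewrite /g /= cc' => /addrI ->.
exfalso; apply: nv.
(* A collision with distinct scalars would express [v] through old vectors. *)
have -> : v = (c - c')^-1 *: ((-1) *: u + u') + 0.
  rewrite addr0 scaleN1r [- u + u']addrC.
  have : c *: v - c' *: v = u' - u.
    have e : c *: v + u = c' *: v + u' := guu'.
    by rewrite -[c *: v](addrK u) e (addrC (c' *: v)) addrAC addrK.
  by rewrite -scalerBl => <-; rewrite scalerA mulVf ?scale1r// subr_eq0.
have frac0 : frac_vec (0 : 'M[K]_(m, a)) = 0.
  by apply/matrixP => i j; rewrite !mxE row0 linear0 rmorph0 mulr0.
rewrite frac_vecZ frac0; apply: (approximableZ _ _ (approximable0 l b)).
by rewrite frac_vecZ; exact: (approximableZ _ ub u'b).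
Qed.

(** The count starts at |K|^(n b) and gains a factor |K| per step; after d steps it reaches |K|^(m
    a), the number of all digit matrices. *)
Lemma approximable_all (a b d : nat) : (n * b + d = m * a)%N ->
  (forall (p : 'cV[{poly K}]_m) (q : 'cV[{poly K}]_n),
    (forall i, (size (q i 0%R) <= b)%N) ->
    (forall j, labs R ((Y *m lpolyv q + lpolyv p) j 0) < expR (- a%:R)) -> q = 0) ->
  forall x, approximable (- a%:Z + d%:Z) (b + d) x.
Proof.
move=> nbd nosol.
have step k : (forall x, approximable (- a%:Z + k%:Z) (b + k) x) \/
    (#|K| ^ (n * b + k) <= #|frac_approx (- a%:Z + k%:Z) (b + k) a|)%N.
  elim: k => [|k [all|IH]].
  - by right; rewrite !addn0 addr0; exact: frac_approx_card0.
  - left=> x; apply: approximableS (all x); last by rewrite leq_add2l.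
    by rewrite lerD2l lez_nat.
  have [|all|IH'] := @frac_approx_card_step (- a%:Z + k%:Z) (b + k) a.
  - by rewrite lerDl.
  - left=> x; apply: approximableS (all x); last by rewrite leq_add2l.
    by rewrite lerD2l lez_nat.
  right; rewrite addnS expnS; apply: (leq_trans (leq_mul (leqnn _) IH)).
  by rewrite addnS -addn1 PoszD addrA.
have [//|] := step d; rewrite nbd => full x.
have [v [p xpv]] := frac_vec_ex a x.
apply/(approximable_frac _ _ xpv); first by rewrite lerDl.
have /eqP fT : frac_approx (- a%:Z + d%:Z) (b + d) a == [set: 'M[K]_(m, a)]%SET.
  by rewrite eqEcard finset.subsetT/= cardsT card_mx.
by have := finset.in_setT v; rewrite -fT => /frac_approxP.
Qed.

End InhomogeneousDirichlet.

(** * Exponents as suprema *)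

Section Suprema.
Variable R : realType.

Lemma expRn_lt (k : nat) (x e : R) : (0 < k)%N -> 0 <= x ->
  (x ^+ k < expR (k%:R * e)) = (x < expR e).
Proof.
by move=> k0 x0; rewrite expRM_natl ltr_pXn2r// nnegrE expR_ge0.
Qed.

Lemma ereal_sup_le1 (S : set R) : (ereal_sup [set w%:E | w in S] <= 1%:E)%E ->
  forall w, 1 < w -> ~ S w.
Proof.
move=> S1 w w1 Sw; have : (w%:E <= 1%:E)%E.
  by apply: le_trans S1; apply: ereal_sup_ubound; exists w.
by rewrite lee_fin leNgt w1.
Qed.

Lemma ereal_sup_gt1 (S : set R) : ~ (ereal_sup [set w%:E | w in S] <= 1%:E)%E ->
  exists2 w, 1 < w & S w.
Proof.
move=> S1; apply: contrapT => nS; apply: S1; apply: ge_ereal_sup => _ [w Sw <-].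
by rewrite lee_fin leNgt; apply/negP => w1; apply: nS; exists w.
Qed.

Lemma ereal_sup_ge1 (S : set R) : (forall w, 0 <= w -> w < 1 -> S w) ->
  (1%:E <= ereal_sup [set w%:E | w in S])%E.
Proof.
move=> S1; apply/lee_addgt0Pr => e e0.
(* The maximum keeps the exponent nonnegative when e > 1. *)
apply: (@le_trans _ _ ((Num.max 0 (1 - e))%:E + e%:E)%E).
  by rewrite -EFinD lee_fin -lerBlDr le_max lexx orbT.
apply: leeD => //; apply: ereal_sup_ubound; exists (Num.max 0 (1 - e)) => //.
by apply: S1; rewrite ?le_max ?lexx// gt_max ltr01 ltrBlDr ltrDl.
Qed.

End Suprema.

(** * From homogeneous upper bounds to inhomogeneous lower bounds *)

Section LowerBound.
Variables (R : realType) (K : finFieldType) (m n : nat).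
Variable Y : 'M[laurent K]_(m, n).

Lemma prodabs_le k (y : 'cV[laurent K]_k) : prodabs R y <= supnorm R y ^+ k.
Proof.
rewrite (_ : supnorm R y ^+ k = \prod_(i < k) supnorm R y); last first.
  by rewrite prodr_const card_ord.
by apply: ler_prod => i _; rewrite labs_ge0 labs_le_supnorm.
Qed.

Lemma prodabs_plus_le k (y : 'cV[laurent K]_k) :
  1 <= supnorm R y -> prodabs_plus R y <= supnorm R y ^+ k.
Proof.
move=> y1; rewrite (_ : supnorm R y ^+ k = \prod_(i < k) supnorm R y); last first.
  by rewrite prodr_const card_ord.
by apply: ler_prod => i _; rewrite le_max ler01 ge_max labs_le_supnorm y1.
Qed.

(** In the notation of [omega_ge1], this is w T <= m (a - d) with T = n (b + d + 1). Both sides have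
    leading term m n h N, up to the factor w < 1, so a large N absorbs the rest. *)
Lemma dirichlet_parameters (mr nr Nr h w : R) : 0 <= mr -> 0 <= nr -> 0 <= Nr ->
  1 <= h -> 0 <= w -> w < 1 ->
  mr * mr + nr * mr + nr <= (1 - w) * (mr * nr) * Nr ->
  w * (nr * (mr * h * Nr + mr * h + 1)) <= mr * (nr * h * Nr + h - mr * h).
Proof.
move=> m0 n0 N0 h1 w0 w1 wN.
have nm0 : 0 <= nr * mr by exact: mulr_ge0.
have h0 : 0 <= h by exact: le_trans h1.
have le1 : h * (mr * mr + nr * mr + nr) <= h * ((1 - w) * (mr * nr) * Nr).
  by rewrite ler_wpM2l.
have le2 : w * (nr * mr * h) <= nr * mr * h by rewrite ler_piMl ?mulr_ge0// ltW.
have le3 : w * nr <= nr by rewrite ler_piMl// ltW.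
have le4 : nr <= h * nr by rewrite ler_peMl.
have le5 : 0 <= mr * h by rewrite mulr_ge0.
nra.
Qed.

(** For an exponent slightly above 1 the homogeneous system eventually has no solution, which is the
    hypothesis of [approximable_all]; the approximations it provides have exponent close to 1. *)
Lemma omega_ge1 (theta : 'cV[laurent K]_m) : (0 < m)%N -> (0 < n)%N ->
  (omega R Y 0 <= 1%:E)%E -> (1%:E <= omega R Y theta)%E.
Proof.
move=> m_gt0 n_gt0 om0; apply: ereal_sup_ge1 => w w0 w1; split=> // T0.
pose N := (Num.truncn (((m * m + n * m + n)%:R / ((1 - w) * (m * n)%:R)))).+1.
have mn0 : 0 < (m * n)%:R :> R by rewrite ltr0n muln_gt0 m_gt0.
have NP : (m * m + n * m + n)%:R <= (1 - w) * (m * n)%:R * N%:R.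
  have d0 : 0 < (1 - w) * (m * n)%:R by rewrite mulr_gt0// subr_gt0.
  by rewrite mulrC -ler_pdivrMr//; apply: ltW; exact: truncnS_gt.
pose w' : R := 1 + (n * N)%:R^-1.
have nN0 : 0 < (n * N)%:R :> R by rewrite ltr0n muln_gt0 n_gt0.
have w'1 : 1 < w' by rewrite ltrDl invr_gt0.
have [T1 nosol] : exists T1 : R, forall T, T1 <= T -> 1 <= T ->
    forall (p : 'cV[{poly K}]_m) (q : 'cV[{poly K}]_n), q != 0 ->
    supnorm R (Y *m lpolyv q + lpolyv p + 0) ^+ m < expR (- w' * T) ->
    supnorm R (lpolyv q) ^+ n < expR T -> False.
  apply: contrapT => /forallNP h; apply: (ereal_sup_le1 om0 w'1); split.
    by rewrite (le_trans ler01)// ltW.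
  move=> T2; have /existsNP[T /not_implyP[T2T /not_implyP[T_ge1]]] := h T2.
  move=> /existsNP[p /existsNP[q /not_implyP[q0 /not_implyP[Yq /not_implyP[qT _]]]]].
  by exists T; split=> //; exists p, q.
pose h := (Num.truncn (Num.max T0 T1)).+1.
have [T0h T1h] : T0 <= h%:R /\ T1 <= h%:R.
  have : Num.max T0 T1 < h%:R by exact: truncnS_gt.
  by rewrite gt_max => /andP[/ltW ? /ltW ?].
have h1 : 1 <= h%:R :> R by rewrite ler1n.
(* Chosen so that w' n b = m a, where the homogeneous system is unsolvable, and n b + d = m a. *)
pose b := (m * h * N)%N; pose a := (n * h * N + h)%N; pose d := (m * h)%N.
have nbd : (n * b + d = m * a)%N by rewrite /b /d /a; ring.
have nosol_ab (p : 'cV[{poly K}]_m) (q : 'cV[{poly K}]_n) :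
    (forall i, (size (q i 0%R) <= b)%N) ->
    (forall j, labs R ((Y *m lpolyv q + lpolyv p) j 0) < expR (- a%:R)) -> q = 0.
  move=> qs Yq; apply: contrapT => /eqP q0.
  have hnb : h%:R <= (n * b)%:R :> R.
    by rewrite ler_nat /b mulnA mulnA mulnAC leq_pmull// !muln_gt0 n_gt0 m_gt0.
  apply: (nosol (n * b)%:R _ _ p q q0).
  - exact: le_trans hnb.
  - exact: le_trans hnb.
  - rewrite addr0 (_ : - w' * _ = m%:R * - a%:R).
      rewrite expRn_lt ?supnorm_ge0//; apply: supnorm_lt; [exact: expR_gt0|].
      exact: Yq.
    rewrite /w' /b /a !natrM natrD !natrM; field.
    by rewrite !pnatr_eq0 -!lt0n n_gt0.
  - rewrite natrM expRn_lt ?supnorm_ge0//; apply: supnorm_lt; first exact: expR_gt0.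
    by move=> i; rewrite lpolyvE labs_lpoly_lt.
(* The approximating [q] may vanish; adding X^(b+d) to each coordinate makes it nonzero, and the
   target is shifted to compensate. *)
pose c : 'cV[{poly K}]_n := const_mx 'X^(b + d).
have [p [q [qs Yq]]] := approximable_all nbd nosol_ab (theta + Y *m lpolyv c).
have szq' i : size ((q + c) i 0%R) = (b + d).+1.
  by rewrite !mxE addrC size_polyDl size_polyXn// ltnS.
exists (n * (b + d).+1)%:R.
have hT : h%:R <= (n * (b + d).+1)%:R :> R.
  rewrite ler_nat -[leqLHS]mul1n leq_mul// leqW// (leq_trans _ (leq_addl _ _))//.
  by rewrite /d leq_pmull.
split; [exact: le_trans hT|exact: le_trans hT|].
exists p, (q + c); split.
- apply/eqP => q'0; have := szq' (Ordinal n_gt0).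
  by rewrite q'0 mxE size_poly0.
- have -> : Y *m lpolyv (q + c) + lpolyv p + theta =
    Y *m lpolyv q + lpolyv p + (theta + Y *m lpolyv c).
    rewrite /lpolyv map_mxD mulmxDr -!addrA; congr (_ + _).
    by rewrite addrC -addrA.
  apply: (@lt_le_trans _ _ (expR (m%:R * (- a%:Z + d%:Z)%:~R))).
    rewrite expRn_lt ?supnorm_ge0//; apply: supnorm_lt; first exact: expR_gt0.
    exact: Yq.
  rewrite ler_expR intrD mulrNz -!pmulrn mulNr -lerN2 opprK -mulrN opprD opprK.
  rewrite /a /b /d !natrM -addn1 !natrD !natrM; apply: dirichlet_parameters => //.
  by move: NP; rewrite !natrD !natrM.
- rewrite natrM expRn_lt ?supnorm_ge0//; apply: supnorm_lt; first exact: expR_gt0.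
  by move=> i; rewrite lpolyvE labs_lpoly_lt szq'.
Qed.

(** Products are at most powers of the norm; for [prodabs_plus] this uses that a nonzero polynomial
    vector has norm at least 1. *)
Lemma omega_le_omega_times (theta : 'cV[laurent K]_m) :
  (omega R Y theta <= omega_times R Y theta)%E.
Proof.
apply: le_ereal_sup => _ [w [w0 sol] <-]; exists w => //; split=> // T0.
have [T [T0T T1 [p [q [q0 Yq qT]]]]] := sol T0.
exists T; split=> //; exists p, q; split=> //.
  by apply: le_lt_trans Yq; exact: prodabs_le.
by apply: le_lt_trans qT; apply: prodabs_plus_le; exact: supnorm_lpolyv_ge1.
Qed.

End LowerBound.

(** * From local to almost everywhere hypotheses *)

Section LocalToGlobal.
Variables (R : realType) (K : finFieldType) (m n : nat).
Local Notation Mat := 'M[laurent K]_(m, n).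
Implicit Types mu nu : {measure set (borel Mat) -> \bar R}.

(** Near almost every point a restriction of [mu] satisfies [P]; [A] stays null for it, hence [B] is
    null there, and [negligible_locally] collects these local statements. *)
Lemma negligible_almost_everywhere_locally
    (P : {measure set (borel Mat) -> \bar R} -> Prop) (A B : set Mat) mu :
  (forall nu, P nu -> nu.-negligible A -> nu.-negligible B) ->
  almost_everywhere_locally P mu -> mu.-negligible A -> mu.-negligible B.
Proof.
move=> loc Pmu muA.
set Z := [set Y0 : Mat | exists (V : set (borel Mat)) (mV : measurable V),
  nbhs Y0 (V : set Mat) /\ P (mrestr mu mV)].
have muZ : mu.-negligible (~` Z) by exact: Pmu.
have muBZ : mu.-negligible (B `&` Z).
  apply: negligible_locally => Y [BY [V [mV [YV PV]]]].
  have [k kV] := open_cell_nbhs R YV.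
  exists (k, mxpart k Y); split=> //.
  have [|C [mC C0 BC]] := loc _ PV.
    have [A' [mA' A'0 AA']] := muA; exists A'; split=> //.
    apply/eqP; rewrite -measure_le0 -A'0; apply: le_measure; rewrite ?inE//.
    exact: measurableI.
  exists (C `&` V); split; [exact: measurableI|exact: C0|].
  by move=> Z' [[BZ' _] /kV VZ']; split=> //; exact: BC.
apply: negligibleS (negligibleU muZ muBZ) => Y BY.
by have [ZY|ZY] := pselect (Z Y); [right|left].
Qed.

End LocalToGlobal.

(** * The upper bounds *)

Section Times.
Variable R : realType.

Lemma truncn_div (L t0 : nat) (T : R) : (0 < L)%N -> (L * t0.+1)%:R <= T ->
  exists t : nat, [/\ (t0 < t)%N, (L * t)%:R <= T & T < (L * t.+1)%:R].
Proof.
move=> L0 LT; have L0' : 0 < L%:R :> R by rewrite ltr0n.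
have T0 : 0 <= T by apply: le_trans LT.
have TL : 0 <= T / L%:R by rewrite divr_ge0// ltW.
have Tlt : T / L%:R < (Num.truncn (T / L%:R)).+1%:R by exact: truncnS_gt.
exists (Num.truncn (T / L%:R)); split.
- rewrite -ltnS -(ltr_nat R); apply: le_lt_trans Tlt.
  by rewrite ler_pdivlMr// mulrC -natrM.
- by rewrite natrM mulrC -ler_pdivlMr// truncn_le.
- by rewrite natrM mulrC -ltr_pdivrMr.
Qed.

End Times.

(** * The exponent for the sup norm *)

Section Ordinary.
Variables (R : realType) (K : finFieldType) (m n : nat) (theta : 'cV[laurent K]_m).
Local Notation Mat := 'M[laurent K]_(m, n).
Local Notation shape := ({ffun 'I_m -> nat} * {ffun 'I_n -> nat})%type.
Variable mu : {measure set (borel Mat) -> \bar R}.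
Hypotheses (m_gt0 : (0 < m)%N) (n_gt0 : (0 < n)%N).

(** Beyond the common term n m D t, the right side has at least m t, the left side m t / 2 and a
    constant absorbed by the lower bound on t. *)
Lemma ordinary_parameters (mr nr D t c : R) : 1 <= mr -> 1 <= nr -> 2 <= D ->
  2 * (nr * mr * D + nr + mr + 1) <= t -> nr * D + 1 <= c ->
  (1 + (2 * nr * D)^-1) * (nr * (mr * D * (t + 1) + 1)) <= mr * (c * t).
Proof.
move=> m1 n1 D2 t_ge c_ge.
have nD0 : 0 < 2 * nr * D by nra.
have D0 : 0 < 2 * D by lra.
have nr0 : nr != 0 by rewrite gt_eqF//; lra.
have Dn0 : D != 0 by rewrite gt_eqF//; lra.
have t0 : 0 <= t by apply: le_trans t_ge; nra.
have -> : (1 + (2 * nr * D)^-1) * (nr * (mr * D * (t + 1) + 1)) =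
  nr * (mr * D * (t + 1) + 1) + (mr * (t + 1)) / 2 + (2 * D)^-1.
  by field; rewrite nr0 Dn0.
have h : (2 * D)^-1 <= 1 by rewrite invf_le1//; lra.
apply: (@le_trans _ _ (mr * ((nr * D + 1) * t))); last first.
  by rewrite ler_wpM2l ?ler_wpM2r//; lra.
have : mr * t >= t by rewrite ler_peMl.
nra.
Qed.

Lemma omega_transference : contracting mu ->
  mu.-negligible [set Y : Mat | ~ (omega R Y 0 <= 1%:E)%E] ->
  mu.-negligible [set Y : Mat | ~ (omega R Y theta <= 1%:E)%E].
Proof.
move=> contr neg0.
(* T is discretised in steps of n m D: of the gain 1 + 1/(k+1) in the exponent, e^-t
   is spent on the contraction, and what is left still exceeds 1. *)
pose D k := (2 * k.+1)%N; pose c k := (n * D k + (2 * n).-1)%N.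
pose P k t : seq shape := [:: ([ffun=> (c k * t)%N], [ffun=> (m * D k * t.+1)%N])].
(* As D = 2 (k + 1), the gain n D / (k + 1) equals 2 n; the unit taken off in [c k] is the e^-t that
   [small_form] restores. *)
have c1 k : (c k).+1 = (n * D k + 2 * n)%N.
  by rewrite /c -addnS prednK// muln_gt0.
have cD k : (n * D k + 1 <= c k)%N.
  by rewrite leq_add2l; move: n_gt0; lia.
have c0 k : (0 < c k)%N by apply: leq_trans (cD k); rewrite addn1.
pose S k : set Mat := [set Y | forall t0, exists t tau p q,
  [/\ (t0 <= t)%N, tau \in P k t, admissible tau p q & small_form R theta t tau p q Y]].
have negS : mu.-negligible (\bigcup_k S k).
  apply: negligible_bigcup => k.
  apply: (@small_form_limsup_negligible R K m n theta mu _ (P k) 1 0 0 contr).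
  - move=> t tau _; rewrite inE => /eqP ->; exists (Ordinal m_gt0) => /=.
    by rewrite ffunE leq_pmull.
  - by move=> t tau M s _; rewrite inE => /eqP -> _ i j /=; rewrite !ffunE.
  - by [].
  apply: negligibleS neg0 => Y /= YH om0.
  have D2 : (2 <= D k)%N by rewrite /D; lia.
  pose w' : R := 1 + (2 * n%:R * (D k)%:R)^-1.
  have w'1 : 1 < w' by rewrite ltrDl invr_gt0 !mulr_gt0 ?ltr0n// (leq_trans _ D2).
  apply: (ereal_sup_le1 om0 w'1); split; first by rewrite (le_trans ler01)// ltW.
  move=> T0.
  pose t0 := maxn (Num.truncn T0).+1 (2 * (n * m * D k + n + m + 1)).
  have [t [tau [t0t]]] := YH t0; rewrite inE => /eqP -> [p [q [q0 qs Yq]]].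
  have tT : t%:R <= (n * (m * D k * t.+1).+1)%:R :> R.
    rewrite ler_nat (leq_trans (leqnSn t))// (leq_trans _ (leq_pmull _ n_gt0))//.
    by rewrite leqW// leq_pmull// muln_gt0 m_gt0 (leq_trans _ D2).
  (* The inner successor appears because [admissible] allows degree [tau.2 i], that is, norm below
     e^(tau.2 i + 1). *)
  exists (n * (m * D k * t.+1).+1)%:R; split.
  - apply: le_trans tT; apply: (@le_trans _ _ (Num.truncn T0).+1%:R).
      by apply: ltW; exact: truncnS_gt.
    by rewrite ler_nat (leq_trans (leq_maxl _ _) t0t).
  - apply: le_trans tT; rewrite ler1n; apply: leq_trans t0t.
    by rewrite leq_max.
  exists p, q; split=> //.
  - apply: (@lt_le_trans _ _ (expR (m%:R * - (c k * t)%:R))).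
      rewrite expRn_lt ?supnorm_ge0//; apply: supnorm_lt; first exact: expR_gt0.
      by move=> j; rewrite addr0; have := Yq j; rewrite /= ffunE.
    rewrite ler_expR mulNr mulrN lerN2 natrM -natr1 (natrM _ (m * D k)) natrM -natr1.
    rewrite [(c k * t)%:R]natrM.
    apply: ordinary_parameters; rewrite ?ler1n// ?(ler_nat _ 2)//.
    + rewrite (_ : 2 * _ = (2 * (n * m * D k + n + m + 1))%:R) ?ler_nat; last first.
        by rewrite natrM !natrD !natrM.
      by apply: leq_trans t0t; rewrite leq_max leqnn orbT.
    + by rewrite -natrM natr1 ler_nat -addn1.
  - rewrite natrM expRn_lt ?supnorm_ge0//; apply: supnorm_lt; first exact: expR_gt0.
    by move=> i; rewrite lpolyvE labs_lpoly_lt; have := qs i; rewrite /= ffunE.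
apply: negligibleS negS => Y /= /ereal_sup_gt1[w w1 [w0 sol]].
have kw : exists k : nat, 1 + k.+1%:R^-1 <= w.
  have w10 : 0 < w - 1 by rewrite subr_gt0.
  exists (Num.truncn (w - 1)^-1); rewrite -lerBrDl invf_ple ?posrE//.
  by apply: ltW; exact: truncnS_gt.
have [k kw'] := kw; exists k => // t0.
pose L := (n * (m * D k))%N.
have L0 : (0 < L)%N by rewrite /L !muln_gt0 n_gt0 m_gt0.
have [T [T0T T1 [p [q [q0 Yq qT]]]]] := sol (L * t0.+1)%:R.
have [t [t0t tT Tt]] := truncn_div L0 T0T.
exists t, ([ffun=> (c k * t)%N], [ffun=> (m * D k * t.+1)%N]), p, q; split.
- exact: ltnW.
- by rewrite inE.
- split=> //= [i|j]; rewrite ffunE.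
    apply: leqW; rewrite -(labs_lpoly_lt R) -lpolyvE.
    apply: le_lt_trans (labs_le_supnorm _ _ _) _.
    rewrite -(expRn_lt _ n_gt0) ?supnorm_ge0//; apply: lt_trans qT _.
    by rewrite ltr_expR -natrM mulnA.
  (* Since c t > 0, every coordinate is constrained and the normalisation of [p] is vacuous. *)
  move/eqP; rewrite muln_eq0 -!leqn0 leqNgt c0/= leqn0 => /eqP tE.
  by rewrite tE in t0t.
move=> j _; rewrite /= ffunE; apply: le_lt_trans (labs_le_supnorm _ _ _) _.
rewrite -(expRn_lt _ m_gt0) ?supnorm_ge0//; apply: lt_le_trans Yq _.
rewrite ler_expR mulNr mulrN lerN2.
apply: (@le_trans _ _ ((1 + k.+1%:R^-1) * (L * t)%:R)); last first.
  by apply: ler_pM => //; rewrite addr_ge0.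
rewrite (_ : (c k * t + t)%N = ((n * D k + 2 * n) * t)%N); last first.
  by rewrite -c1 mulSn addnC.
rewrite /L /D !natrM !natrD !natrM le_eqVlt; apply/orP; left; apply/eqP.
by field.
Qed.

End Ordinary.

(** In the application [v] and [vt] are the sums of the levels before and after subtracting t, with
    a = L t and b = m t. *)
Lemma level_count (v vt a b m : nat) :
  (v <= vt + b -> a + (b + b) < v + m -> a + b <= vt + m)%N.
Proof. lia. Qed.

Lemma level_count_cap (a b t : nat) : (t <= b -> a + b <= a + (b + b) - t)%N.
Proof. lia. Qed.

(** * The multiplicative exponent *)

Section Multiplicative.
Variables (R : realType) (K : finFieldType) (m n : nat) (theta : 'cV[laurent K]_m).
Local Notation Mat := 'M[laurent K]_(m, n).
Local Notation shape := ({ffun 'I_m -> nat} * {ffun 'I_n -> nat})%type.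
Variable mu : {measure set (borel Mat) -> \bar R}.
Hypothesis m_gt0 : (0 < m)%N.

Definition shapes (B : nat) : seq shape :=
  [seq ([ffun j => val (uv.1 j)], [ffun i => val (uv.2 i)]) |
    uv : {ffun 'I_m -> 'I_B.+1} * {ffun 'I_n -> 'I_B.+1}
      <- enum {: {ffun 'I_m -> 'I_B.+1} * {ffun 'I_n -> 'I_B.+1}}].

Lemma size_shapes B : size (shapes B) = (B.+1 ^ (m + n))%N.
Proof. by rewrite size_map -cardE card_prod !card_ffun !card_ord expnD. Qed.

Lemma mem_shapes B (tau : shape) :
  (forall j, (tau.1 j <= B)%N) -> (forall i, (tau.2 i <= B)%N) -> tau \in shapes B.
Proof.
case: tau => u s /= uB sB; apply/mapP.
exists ([ffun j => inord (u j)], [ffun i => inord (s i)]); first by rewrite mem_enum.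
by congr pair; apply/ffunP => j; rewrite !ffunE /= inordK ?ltnS.
Qed.

Lemma max1_labs_lpoly (q : {poly K}) :
  Num.max 1 (labs R (lpoly q)) = expR ((size q).-1)%:R.
Proof.
have [->|q0] := eqVneq q 0.
  by rewrite rmorph0 labs0 size_poly0 expR0; apply/max_idPl.
by rewrite -labs_lpoly//; apply/max_idPr; exact: labs_lpoly_ge1.
Qed.

Lemma prod_expR (I : finType) (f : I -> nat) :
  \prod_(i : I) expR (f i)%:R = expR (\sum_(i : I) f i)%:R :> R.
Proof. by rewrite natr_sum expR_sum. Qed.

(** The largest v with |z| < e^-v, capped at [B] because z may vanish. *)
Lemma labs_level (B : nat) (z : laurent K) : labs R z < 1 ->
  exists v : nat, [/\ (v <= B)%N, labs R z < expR (- v%:R) &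
    v = B \/ expR (- v.+1%:R) <= labs R z].
Proof.
move=> z1.
have ex : exists v, (v <= B)%N && (labs R z < expR (- v%:R)).
  by exists 0%N; rewrite leq0n oppr0 expR0.
have ub v : (v <= B)%N && (labs R z < expR (- v%:R)) -> (v <= B)%N by move=> /andP[].
have [v /andP[vB zv] vmax] := ex_maxnP ex ub.
exists v; split=> //; have [->|vB'] := eqVneq v B; [by left|right].
rewrite leNgt; apply/negP => zv1; have := vmax v.+1.
by rewrite zv1 andbT ltn_neqAle vB' vB ltnn => /(_ isT).
Qed.

(** A small product leaves single coordinates unbounded. Values already below 1 are kept, so the
    reduction never increases the product. *)
Lemma reduce_poly_part (x : laurent K) :
  exists p, labs R (x + lpoly p) < 1 /\ labs R (x + lpoly p) <= labs R x.
Proof.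
have [x1|x1] := ltP (labs R x) 1; first by exists 0; rewrite rmorph0 addr0.
have [p xp] := labs_addpoly_lt1 R x; exists p; split=> //.
by rewrite ltW// (lt_le_trans xp).
Qed.

Lemma omega_times_transference : strongly_contracting mu ->
  mu.-negligible [set Y : Mat | ~ (omega_times R Y 0 <= 1%:E)%E] ->
  mu.-negligible [set Y : Mat | ~ (omega_times R Y theta <= 1%:E)%E].
Proof.
move=> contr neg0.
(* T is discretised in steps of L. The product condition is split into boxes of sides
   e^-(u_j + t); after the contraction by e^-t there remains sum u_j >= (L + m) t - m,
   hence an exponent exceeding 1. *)
pose L k := (2 * k.+1 * m)%N; pose N k := (L k + 2 * m)%N.
(* [N k] equals (1 + 1/(k+1)) [L k]: the levels sum to more than N t - m, the m being lost by
   rounding, and m t of this is spent on the contraction. *)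
have L0 k : (0 < L k)%N by rewrite /L !muln_gt0 m_gt0.
pose good k t (tau : shape) :=
  (\sum_i tau.2 i <= L k * t.+1)%N && ((L k + m) * t <= \sum_j tau.1 j + m)%N.
pose P k t := [seq tau <- shapes (N k * t.+1) | good k t tau].
pose S k : set Mat := [set Y | forall t0, exists t tau p q,
  [/\ (t0 <= t)%N, tau \in P k t, admissible tau p q & small_form R theta t tau p q Y]].
have negS : mu.-negligible (\bigcup_k S k).
  apply: negligible_bigcup => k.
  apply: (@small_form_limsup_negligible R K m n theta mu _ (P k)
    ((N k).+1 ^ (m + n)) (m + n) 1 contr).
  - move=> t tau t1; rewrite mem_filter => /andP[/andP[_ ut] _].
    (* If all exponents were below t, their sum would be at most m (t - 1), against [ut]. This needs
       t > 0, hence the threshold 1. *)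
    apply: contrapT => /forallNP small.
    have : (\sum_j tau.1 j <= \sum_(j < m) t.-1)%N.
      apply: leq_sum => j _; rewrite -ltnS prednK// ltnNge; apply/negP; exact: small.
    rewrite sum_nat_const card_ord => su.
    have : ((L k + m) * t <= m * t.-1 + m)%N by rewrite (leq_trans ut)// leq_add2r.
    by rewrite [(m * t.-1 + m)%N]addnC -mulnS prednK// mulnDl
      -[leqRHS]add0n leq_add2r leqn0 muln_eq0 !gtn_eqF ?L0.
  - by [].
  - move=> t; rewrite size_filter (leq_trans (count_size _ _))// size_shapes -expnMn.
    by rewrite leq_exp2r ?addn_gt0 ?m_gt0// mulSn -[(N k * t.+1).+1]add1n leq_add2r.
  apply: negligibleS neg0 => Y /= YH om0.
  pose w' : R := 1 + (2 * (L k)%:R)^-1.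
  have w'1 : 1 < w' by rewrite ltrDl invr_gt0 mulr_gt0 ?ltr0n.
  apply: (ereal_sup_le1 om0 w'1); split; first by rewrite (le_trans ler01)// ltW.
  move=> T0.
  pose t0 := maxn (Num.truncn T0).+1 (2 * (L k + m + 3)).
  have [t [tau [t0t]]] := YH t0; rewrite mem_filter => /andP[/andP[st ut] _].
  move=> [p [q [q0 qs Yq]]].
  have tT : t%:R <= (L k * t.+1).+1%:R :> R.
    by rewrite ler_nat (leq_trans (leqnSn t))// leqW// leq_pmull.
  exists (L k * t.+1).+1%:R; split.
  - apply: le_trans tT; apply: (@le_trans _ _ (Num.truncn T0).+1%:R).
      by apply: ltW; exact: truncnS_gt.
    by rewrite ler_nat (leq_trans (leq_maxl _ _) t0t).
  - apply: le_trans tT; rewrite ler1n; apply: leq_trans t0t.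
    by rewrite leq_max.
  exists p, q; split=> //.
  - apply: (@le_lt_trans _ _ (\prod_(j < m) expR (- (tau.1 j)%:R))).
      apply: ler_prod => j _; rewrite labs_ge0 addr0 /=; apply: ltW; exact: Yq.
    rewrite -expR_sum sumrN -natr_sum ltr_expR mulNr ltrN2.
    have t_ge : 2 * ((L k)%:R + m%:R + 3) <= t%:R :> R.
      rewrite (_ : 2 * _ = (2 * (L k + m + 3))%:R); last by rewrite natrM !natrD.
      by rewrite ler_nat (leq_trans _ t0t)// leq_max leqnn orbT.
    have ut' : ((L k)%:R + m%:R) * t%:R <= (\sum_j tau.1 j)%:R + m%:R :> R.
      by rewrite -!natrD -natrM ler_nat.
    have m1 : 1 <= m%:R :> R by rewrite ler1n.
    have L1 : 1 <= (L k)%:R :> R by rewrite ler1n.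
    have -> : w' * (L k * t.+1).+1%:R =
      (L k)%:R * (t%:R + 1) + 1 + (t%:R + 1) / 2 + (2 * (L k)%:R)^-1.
      rewrite /w' -[(L k * t.+1).+1%:R]natr1 natrM -[t.+1%:R]natr1; field.
      by rewrite gt_eqF// (lt_le_trans ltr01).
    have : (2 * (L k)%:R)^-1 <= 1 :> R by rewrite invf_le1//; lra.
    have : t%:R <= m%:R * t%:R :> R by rewrite ler_peMl.
    lra.
  - apply: (@le_lt_trans _ _ (\prod_(i < n) expR (tau.2 i)%:R)).
      apply: ler_prod => i _; rewrite lpolyvE max1_labs_lpoly expR_ge0 ler_expR.
      by rewrite ler_nat -subn1 leq_subLR add1n qs.
    by rewrite prod_expR ltr_expR ltr_nat ltnS.
apply: negligibleS negS => Y /= /ereal_sup_gt1[w w1 [w0 sol]].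
have kw : exists k : nat, 1 + k.+1%:R^-1 <= w.
  have w10 : 0 < w - 1 by rewrite subr_gt0.
  exists (Num.truncn (w - 1)^-1); rewrite -lerBrDl invf_ple ?posrE//.
  by apply: ltW; exact: truncnS_gt.
have [k kw'] := kw; exists k => // t0.
have [T [T0T T1 [p [q [q0 Yq qT]]]]] := sol (L k * t0.+1)%:R.
have [t [t0t tT Tt]] := truncn_div (L0 k) T0T.
pose y := Y *m lpolyv q + lpolyv p + theta.
pose r j := sval (cid (reduce_poly_part (y j 0))).
have [rlt rle] : (forall j, labs R (y j 0 + lpoly (r j)) < 1) /\
    (forall j, labs R (y j 0 + lpoly (r j)) <= labs R (y j 0)).
  by split=> j; rewrite /r; case: cid => e [].
pose z j := y j 0 + lpoly (r j).
(* The cap is harmless: a single coordinate reaching it already yields [sumu]. *)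
pose B := (N k * t)%N.
pose v j := sval (cid (labs_level B (rlt j))).
have vP j : [/\ (v j <= B)%N, labs R (z j) < expR (- (v j)%:R) &
    v j = B \/ expR (- (v j).+1%:R) <= labs R (z j)].
  by rewrite /v; case: cid.
have sumq : (\sum_i (size (q i 0%R)).-1 <= L k * t.+1)%N.
  apply: ltnW; rewrite -(ltr_nat R) -ltr_expR -prod_expR.
  apply: le_lt_trans (_ : expR T < _); last by rewrite ltr_expR.
  apply: le_trans (ltW qT); rewrite /prodabs_plus le_eqVlt; apply/orP; left; apply/eqP.
  by apply: eq_bigr => i _; rewrite lpolyvE max1_labs_lpoly.
have wt : (N k * t)%:R <= w * T.
  apply: (@le_trans _ _ ((1 + k.+1%:R^-1) * (L k * t)%:R)); last first.
    by apply: ler_pM => //; rewrite addr_ge0.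
  have LE : (L k)%:R = 2 * k.+1%:R * m%:R :> R by rewrite -!natrM.
  have NE : (N k)%:R = (L k)%:R + 2 * m%:R :> R by rewrite -!natrM -natrD.
  rewrite !natrM NE LE le_eqVlt; apply/orP; left; apply/eqP.
  by field.
have NtE : (N k * t)%N = (L k * t + (m * t + m * t))%N.
  by have -> : N k = (L k + 2 * m)%N by []; rewrite mul2n -addnn !mulnDl.
have sumu : ((L k + m) * t <= \sum_j (v j - t) + m)%N.
  have [[j vj]|nB] := pselect (exists j, v j = B).
    rewrite (bigD1 j)//= vj -addnA; apply: leq_trans (leq_addr _ _).
    by rewrite /B NtE mulnDl; apply: level_count_cap; exact: leq_pmull.
  (* With no level at the cap, each coordinate is at least e^-(v_j + 1), and the small product
     bounds the sum of the levels from below. *)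
  have vS : (N k * t < \sum_j (v j).+1)%N.
    rewrite -(ltr_nat R) -ltrN2 -ltr_expR natr_sum -sumrN expR_sum.
    apply: (@lt_le_trans _ _ (expR (- w * T))); last by rewrite ler_expR mulNr lerN2.
    apply: le_lt_trans Yq; apply: ler_prod => j _; rewrite expR_ge0 /=.
    apply: le_trans (rle j); have [_ _ [vj|//]] := vP j.
    by exfalso; apply: nB; exists j.
  have vt : (\sum_j v j <= \sum_j (v j - t) + m * t)%N.
    rewrite -[m in (m * t)%N]card_ord -sum_nat_const -big_split /=.
    by apply: leq_sum => j _; rewrite addnC -leq_subLR.
  have vm : (\sum_j (v j).+1 = \sum_j v j + m)%N.
    under eq_bigr do rewrite -addn1.
    by rewrite big_split /= sum_nat_const card_ord muln1.
  by rewrite mulnDl; move: vS; rewrite vm NtE; exact: level_count.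
(* Truncated subtraction makes the coordinates with v_j <= t unconstrained, and there [admissible]
   wants p_j = 0; elsewhere the reduction r_j is added to p_j. *)
exists t, ([ffun j => (v j - t)%N], [ffun i => (size (q i 0%R)).-1]),
  (\col_j if (v j - t)%N == 0%N then 0 else p j 0 + r j), q; split.
- exact: ltnW.
- rewrite mem_filter /good /=; apply/andP; split.
    by under eq_bigr do rewrite ffunE; rewrite sumq; under eq_bigr do rewrite ffunE.
  apply: mem_shapes => i /=; rewrite ffunE.
    have [vB _ _] := vP i; rewrite (leq_trans (leq_subr _ _))// (leq_trans vB)//.
    by rewrite /B leq_mul2l leqnSn orbT.
  apply: leq_trans (leq_trans sumq _); last by rewrite leq_mul2r leq_addr orbT.
  by rewrite (bigD1 i)//= leq_addr.
- split=> //= [i|j]; rewrite ffunE ?leqSpred// mxE => ->.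
  by rewrite eqxx.
move=> j; rewrite /= ffunE => uj; have [_ vj _] := vP j.
rewrite subnK; last by rewrite ltnW// -subn_gt0.
apply: le_lt_trans vj; rewrite le_eqVlt; apply/orP; left; apply/eqP; congr (labs R _).
rewrite /z /y !mxE (gtn_eqF uj) rmorphD /=; ring.
Qed.

End Multiplicative.

Theorem theorem2p1 (R : realType) (K : finFieldType) (m n : nat)
    (hm : (1 <= m)%N) (hn : (1 <= n)%N) :
  (forall mu : {measure set (borel 'M[laurent K]_(m, n)) -> \bar R},
      contracting_ae mu -> (extremal mu <-> inhom_extremal mu)) /\
  (forall mu : {measure set (borel 'M[laurent K]_(m, n)) -> \bar R},
      strongly_contracting_ae mu ->
      (strongly_extremal mu <-> inhom_strongly_extremal mu)).
Proof.
split=> mu contr; (split=> [ext theta|ext]; last exact: (ext 0)).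
- have neg0 : mu.-negligible
      [set Y : 'M[laurent K]_(m, n) | ~ (omega R Y 0 <= 1%:E)%E].
    by apply: negligibleS ext => Y /= nle eq1; apply: nle; rewrite eq1.
  have negt := negligible_almost_everywhere_locally
    (fun nu => @omega_transference R K m n theta nu hm hn) contr neg0.
  apply: negligibleS (negligibleU neg0 negt) => Y /= neq1.
  (* Off both null sets the upper bound is known, and [le0] supplies the lower one through
     [omega_ge1]. *)
  have [le0|] := pselect (omega R Y 0 <= 1%:E)%E; last by left.
  right=> let1; apply: neq1; apply/eqP; rewrite eq_le let1 /=.
  exact: omega_ge1.
- have neg0 : mu.-negligible
      [set Y : 'M[laurent K]_(m, n) | ~ (omega_times R Y 0 <= 1%:E)%E].
    by apply: negligibleS ext => Y /= nle eq1; apply: nle; rewrite eq1.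
  have negt := negligible_almost_everywhere_locally
    (fun nu => @omega_times_transference R K m n theta nu hm) contr neg0.
  apply: negligibleS (negligibleU neg0 negt) => Y /= neq1.
  have [le0|] := pselect (omega_times R Y 0 <= 1%:E)%E; last by left.
  right=> let1; apply: neq1; apply/eqP; rewrite eq_le let1 /=.
  (* The comparison of exponents is used twice: to bound [omega R Y 0] by 1 and to carry the lower
     bound at [theta] over to the multiplicative exponent. *)
  apply: le_trans (omega_le_omega_times R Y theta); apply: omega_ge1 => //.
  exact: le_trans (omega_le_omega_times R Y 0) le0.
Qed.
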